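(* Let $M$ be a complete Riemannian manifold of dimension $m$ and let $\Phi$ be a smooth flow on $M$ with infinitesimal generator $X\in\mathfrak{X}(M)$. Let $p\in M$ be a point with $X_p\neq 0$, $\mathcal{D}^{(p)}=\mathbb{R}$, $$\lambda^-(X_p) < \min_{u\in \mathrm{UT}_pM,\ u\perp X_p} \lambda^-(u),$$ $$\lambda^+(X_p) > m\,\sigma_P(\lambda^+|_p,\tilde\lambda^+|_p) - \min_{u\in \mathrm{UT}_pM,\ u\perp X_p} \tilde\lambda^+(u^\flat),$$ and $$\lambda^+(X_p)\ge \max\{\lambda^+(v_2),\dots,\lambda^+(v_m)\}$$ for an arbitrary basis $v_1:=X_p,v_2,\dots,v_m$ of $\mathrm{T}_pM$. Then there is a unique linear subspace $E_p\subset \mathrm{T}_pM$ of codimension $1$ with $X_p\notin E_p$ and (a) $\lambda^+(X_p) > \max \lambda^+[E_p]$, (b) $\lambda^-(X_p) < \min\lambda^-[E_p\setminus\{0\}]$. In addition, the union $$E := \bigcup_{t\in\mathbb{R}} \bigl(\mathrm{d}\Phi^t[E_p]\times\{\Phi^t(p)\}\bigr)$$ defines an invariant smooth vector subbundle of $\mathrm{T}M|_{\Phi^{\mathbb{R}}(p)}$, and the orbit $\Phi^{\mathbb{R}}(p)=\{\Phi^t(p):t\in\mathbb{R}\}$ through $p$ is thus a generalized relative NAIM (with bundle $E$).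
   Context: $\mathfrak{X}(M)$ is the space of smooth vector fields on $M$. $\mathcal{D}^{(p)}\subseteq\mathbb{R}$ is the open interval of times $t$ for which $\Phi^t(p)$ is defined. $\mathrm{UT}_pM=\{u\in \mathrm{T}_pM:\|u\|=1\}$, and $\flat:\mathrm{T}M\to \mathrm{T}^*M$ is the musical isomorphism $u^\flat=\langle u,\cdot\rangle$. Lyapunov exponents (values in $\overline{\mathbb{R}}=\mathbb{R}\cup\{\pm\infty\}$): for $0\neq v\in \mathrm{T}_pM$, $0\ne t\in\mathcal{D}^{(p)}$ put $\lambda^t(v)=\frac1{|t|}\log\frac{\|\mathrm{d}\Phi^t(v)\|}{\|v\|}$, and $\lambda^t(0)=-\infty$. For $0\neq\omega\in \mathrm{T}_p^*M$, $0\neq t\in\mathcal{D}^{(p)}$ put $\tilde\lambda^t(\omega)=\frac1{|t|}\log\frac{\|(\mathrm{d}\Phi^{-t})^*\omega\|}{\|\omega\|}$, where $(\mathrm{d}\Phi^{-t})^*\omega=\omega\circ \mathrm{d}\Phi^{-t}|_{\Phi^t(p)}\in \mathrm{T}^*_{\Phi^t(p)}M$, and $\tilde\lambda^t(0)=-\infty$. The forward and backward (adjoint) Lyapunov exponents are $$\lambda^+(v)=\limsup_{T\to\sup\mathcal{D}^{(p)}}\lambda^T(v),\quad \lambda^-(v)=\limsup_{T\to\inf\mathcal{D}^{(p)}}\lambda^T(v),$$ and likewise $\tilde\lambda^{\pm}$ from $\tilde\lambda^T$. The restrictions to $\mathrm{T}_pM$ and $\mathrm{T}^*_pM$ are denoted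 $\lambda^+|_p$, $\tilde\lambda^+|_p$. For a set $A$, $\lambda^\pm[A]$ is the image of $A$. Perron regularity coefficient: a Lyapunov exponent $\lambda$ on an $m$-dimensional vector space takes at most $m$ distinct values $\chi_1<\dots<\chi_r$ on nonzero vectors; the sublevel sets $V_i=\{v:\lambda(v)\le\chi_i\}$ are linear subspaces, and $\chi_i$ has multiplicity $\dim V_i-\dim V_{i-1}$ (with $V_0=\{0\}$). Counting values with multiplicity in nondecreasing order gives a tuple $\lambda_1'\le\dots\le\lambda_m'$. For the two dual exponents $\lambda,\tilde\lambda$ with corresponding tuples $(\lambda_i')$, $(\tilde\lambda_i')$, set $\sigma_P(\lambda,\tilde\lambda)=\max\{\lambda_i'+\tilde\lambda_{m-i+1}':1\le i\le m\}$. Generalized relative NAIM: an invariant manifold $N$ together with a continuous invariant (under $\mathrm{d}\Phi^t$) vector bundle $E\subset \mathrm{T}M|_N$, complementary to $\mathrm{T}N$, such that for every $p\in N$: $\max\lambda^+[E_p]<\min\lambda^+[\mathrm{T}_pN\setminus\{0_p\}]$ and $\min\lambda^-[E_p\setminus\{0_p\}]>\max\lambda^-[\mathrm{T}_pN]$. *)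

(* Defs.v *)
From HB Require Import structures.
From mathcomp Require Import all_boot all_order all_algebra finmap.
From mathcomp Require Import all_classical all_reals all_analysis.

Set Implicit Arguments.
Unset Strict Implicit.
Unset Printing Implicit Defensive.
Import Order.TTheory GRing.Theory Num.Theory.
Import numFieldNormedType.Exports.
Local Open Scope classical_set_scope.
Local Open Scope ring_scope.

Section smoothness.
Context {R : realType} {V W : normedModType R}.

(* For open U and finite-dimensional V this is the usual class C^k(U, W). *)
Fixpoint Ck_on (k : nat) (U : set V) (f : V -> W) : Prop :=
  match k with
  | 0 => forall x, U x -> {for x, continuous f}
  | k'.+1 => (forall x, U x -> differentiable f x) /\
             (forall v, Ck_on k' U (fun x => 'D_v f x))
  end.

Definition smooth_on (U : set V) (f : V -> W) : Prop := forall k, Ck_on k U f.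

Definition smooth_near (f : V -> W) (x : V) : Prop :=
  exists2 U, open_nbhs x U & smooth_on U f.

End smoothness.

(* The atlas is indexed by the points of the manifold: [chart p] is a chart
   around p.  Every smooth structure is generated by such an atlas. *)
Record smoothManifold (R : realType) (m : nat) := SmoothManifold {
  carrier :> topologicalType ;
  manifold_hausdorff : hausdorff_space carrier ;
  manifold_second_countable : @second_countable carrier ;
  chart_dom : carrier -> set carrier ;
  chart : carrier -> carrier -> 'rV[R]_m ;
  chart_inv : carrier -> 'rV[R]_m -> carrier ;
  chart_dom_nbhs : forall p, open_nbhs p (chart_dom p) ;
  chart_image_open : forall p, open (chart p @` chart_dom p) ;
  chartK : forall p x, chart_dom p x -> chart_inv p (chart p x) = x ;
  chart_continuous : forall p x, chart_dom p x ->
    {for x, continuous (chart p)} ;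
  chart_inv_continuous : forall p y, (chart p @` chart_dom p) y ->
    {for y, continuous (chart_inv p)} ;
  chart_transition_smooth : forall p q,
    smooth_on (chart p @` (chart_dom p `&` chart_dom q))
              (chart q \o chart_inv p)
}.

Arguments chart_dom {R m M} p : rename.
Arguments chart {R m M} p _ : rename.
Arguments chart_inv {R m M} p _ : rename.

(* T_pM is identified with 'rV[R]_m by means of the chart [chart p]: a row
   vector v at p is the tangent vector with coordinates v in [chart p]. *)

Section maps.
Context {R : realType}.

(* The change of coordinates T_xM -> T_xM from chart p to chart q; the
   coordinates used for T_xM itself are those of chart x. *)
Definition transition {m} {M : smoothManifold R m} (p q x : M) :
    'rV[R]_m -> 'rV[R]_m :=
  'd (chart q \o chart_inv p) (chart p x).

(* The differential of f at x, a map from T_xM to T_(f x)N. *)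
Definition dmap {m n} {M : smoothManifold R m} {N : smoothManifold R n}
    (f : M -> N) (x : M) : 'rV[R]_m -> 'rV[R]_n :=
  'd (chart (f x) \o f \o chart_inv x) (chart x x).

Definition smooth_map {m n} {M : smoothManifold R m} {N : smoothManifold R n}
    (f : M -> N) : Prop :=
  forall x, {for x, continuous f} /\
    smooth_near (chart (f x) \o f \o chart_inv x) (chart x x).

Definition injective_immersion {k m} {N : smoothManifold R k}
    {M : smoothManifold R m} (iota : N -> M) : Prop :=
  [/\ smooth_map iota, injective iota & forall x, injective (dmap iota x)].

Definition smooth_vector_field {m} {M : smoothManifold R m}
    (X : M -> 'rV[R]_m) : Prop :=
  forall q : M, smooth_on (chart q @` chart_dom q)
    (fun y => let x := chart_inv q y in transition x q x (X x)).

(* Smoothness at the end points of I means smoothness in a neighbourhood. *)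
Definition smooth_curve {m} {M : smoothManifold R m} (I : set R)
    (c : R -> M) : Prop :=
  forall t, I t -> {for t, continuous c} /\
    smooth_near (fun s : R^o => chart (c t) (c s)) t.

Definition velocity {m} {M : smoothManifold R m} (c : R -> M) (t : R) :
    'rV[R]_m :=
  derive1 (fun s : R => chart (c t) (c s)) t.

End maps.

Record riemannianManifold (R : realType) (m : nat) := RiemannianManifold {
  base_manifold :> smoothManifold R m ;
  metric : base_manifold -> 'rV[R]_m -> 'rV[R]_m -> R ;
  metric_linear : forall p u a v w,
    metric p u (a *: v + w) = a * metric p u v + metric p u w ;
  metric_sym : forall p u v, metric p u v = metric p v u ;
  metric_pos : forall p u, u != 0 -> 0 < metric p u u ;
  metric_smooth : forall (q : base_manifold) u v,
    smooth_on (chart q @` chart_dom q)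
      (fun y => let x := chart_inv q y in
        metric x (transition q x x u) (transition q x x v) : R^o)
}.

Section riemannian.
Context {R : realType} {m : nat} {M : riemannianManifold R m}.

Definition tnorm (p : M) (u : 'rV[R]_m) : R := Num.sqrt (metric p u u).

Definition unit_tangent (p : M) : set 'rV[R]_m := [set u | tnorm p u = 1].

Definition unit_normal (p : M) (x : 'rV[R]_m) : set 'rV[R]_m :=
  [set u | unit_tangent p u /\ metric p u x = 0].

(* [curve_length p q l]: some piecewise smooth curve from p to q has length
   l; such a curve is a concatenation of smooth curves defined on [0, 1]. *)
Inductive curve_length : M -> M -> R -> Prop :=
| curve_length_nil p : curve_length p p 0
| curve_length_cons (c : R -> M) q l :
    smooth_curve `[0, 1] c -> curve_length (c 1) q l ->
    curve_length (c 0) q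
      (Rintegral lebesgue_measure `[0, 1]
         (fun t => tnorm (c t) (velocity c t)) + l).

(* +oo between distinct connected components *)
Definition riemannian_dist (p q : M) : \bar R :=
  ereal_inf [set l%:E | l in curve_length p q].

Definition complete_riemannian : Prop :=
  forall u : nat -> M,
    (forall e : R, 0 < e -> exists n, forall i j, (n <= i)%N -> (n <= j)%N ->
       (riemannian_dist (u i) (u j) < e%:E)%E) ->
    exists l, (fun n => riemannian_dist (u n) l) @ \oo --> 0%E.

(* T*_pM is the linear dual of T_pM, with the dual norm. *)
Definition conorm (p : M) (w : 'Hom('rV[R]_m, R^o)) : R :=
  sup [set `|w u| | u in unit_tangent p].

Definition flat (p : M) (u : 'rV[R]_m) : 'Hom('rV[R]_m, R^o) :=
  linfun (metric p u : 'rV[R]_m -> R^o).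

End riemannian.
Arguments complete_riemannian {R m} M.

(* [flow_dom p] is the open interval of times at which the flow is defined at
   p; [flow] takes junk values elsewhere.  [flow_dom_shift] together with the
   openness of the flow domain says that the flow is maximal. *)
Record smoothFlow (R : realType) (m : nat) (M : smoothManifold R m) :=
SmoothFlow {
  flow_dom : M -> set R ;
  flow :> R -> M -> M ;
  flow_dom0 : forall p, flow_dom p 0 ;
  flow_dom_itv : forall p, is_interval (flow_dom p) ;
  flow_dom_open : open [set z : R * M | flow_dom z.2 z.1] ;
  flow_dom_shift : forall p s t, flow_dom p s ->
    (flow_dom (flow s p) t <-> flow_dom p (s + t)) ;
  flow0 : forall p, flow 0 p = p ;
  flowD : forall p s t, flow_dom p s -> flow_dom p (s + t) ->
    flow t (flow s p) = flow (s + t) p ;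
  flow_smooth : forall p t, flow_dom p t ->
    {for (t, p), continuous (fun z : R * M => flow z.1 z.2)} /\
    smooth_near (fun z : R^o * 'rV[R]_m =>
                   chart (flow t p) (flow z.1 (chart_inv p z.2)))
                (t, chart p p)
}.

Definition is_generator (R : realType) (m : nat) (M : smoothManifold R m)
    (Phi : smoothFlow M) (X : M -> 'rV[R]_m) : Prop :=
  forall p, is_derive (0 : R^o) (1 : R^o) (fun t => chart p (Phi t p)) (X p).

Section lyapunov.
Context {R : realType} {m : nat} {M : riemannianManifold R m}.
Variable Phi : smoothFlow M.

Definition lyap_at (p : M) (t : R) (v : 'rV[R]_m) : \bar R :=
  if v == 0 then -oo%E
  else (`|t|^-1 * ln (tnorm (Phi t p) (dmap (Phi t) p v) / tnorm p v))%:E.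

(* w o dPhi^(-t), a covector at Phi^t(p) *)
Definition copush (p : M) (t : R) (w : 'Hom('rV[R]_m, R^o)) :
    'Hom('rV[R]_m, R^o) :=
  (w \o linfun (dmap (Phi (- t)) (Phi t p)))%VF.

Definition colyap_at (p : M) (t : R) (w : 'Hom('rV[R]_m, R^o)) : \bar R :=
  if w == 0 then -oo%E
  else (`|t|^-1 * ln (conorm (Phi t p) (copush p t w) / conorm p w))%:E.

(* The filters T -> sup D and T -> inf D, for finite or infinite end points. *)
Definition to_sup (D : set R) : set_system R :=
  filter_from D (fun a => [set t | D t /\ a < t]).

Definition to_inf (D : set R) : set_system R :=
  filter_from D (fun a => [set t | D t /\ t < a]).

Definition lyap_fwd (p : M) (v : 'rV[R]_m) : \bar R :=
  limf_esup (fun t => lyap_at p t v) (to_sup (flow_dom Phi p)).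

Definition lyap_bwd (p : M) (v : 'rV[R]_m) : \bar R :=
  limf_esup (fun t => lyap_at p t v) (to_inf (flow_dom Phi p)).

Definition colyap_fwd (p : M) (w : 'Hom('rV[R]_m, R^o)) : \bar R :=
  limf_esup (fun t => colyap_at p t w) (to_sup (flow_dom Phi p)).

End lyapunov.

Section perron.
Context {R : realType}.

Section multiplicity.
Variables (V : vectType R) (lam : V -> \bar R).

(* chi_1 < ... < chi_r *)
Definition exponent_values : seq (\bar R) :=
  sort <=%O (fset_set (lam @` [set v | v != 0])).

(* The subspace {v | lam v <= c}; junk if this set is not a subspace. *)
Definition sublevel (c : \bar R) : {vspace V} :=
  xget 0%VS [set U : {vspace V} | forall v, v \in U <-> (lam v <= c)%E].

(* dim V_i - dim V_(i-1), with dim V_0 = 0 *)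
Definition multiplicities : seq nat :=
  pairmap (fun a b => (b - a)%N) 0%N
    [seq \dim (sublevel c) | c <- exponent_values].

Definition exponent_tuple : seq (\bar R) :=
  flatten [seq nseq cd.2 cd.1 | cd <- zip exponent_values multiplicities].

End multiplicity.

(* [dual_adde] is the addition of \bar R with +oo + -oo = +oo.  With it, an
   undefined sum makes sigma_P, hence every strict upper bound on an
   expression in sigma_P, fail instead of holding by convention.  Counting
   from 1, the term of index i : 'I_m is lam'_(i+1) + colam'_(m-i). *)
Definition perron_coef (m : nat) (V W : vectType R)
    (lam : V -> \bar R) (colam : W -> \bar R) : \bar R :=
  \big[maxe/-oo%E]_(i < m)
    dual_adde (nth -oo%E (exponent_tuple lam) i)
              (nth -oo%E (exponent_tuple colam) (rev_ord i)).

End perron.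

Section bundles.
Context {R : realType} {k m : nat} {N : smoothManifold R k}.

(* Elements of TM are pairs (q, v) with v in T_qM. *)
Definition fiber {T : Type} (E : set (T * 'rV[R]_m)) (q : T) :
    set 'rV[R]_m := [set v | E (q, v)].

(* A rank r subbundle of TM|_N, for the submanifold N of M immersed by iota,
   whose local frames are of class [reg] when written in charts of N and M. *)
Definition subbundle {M : smoothManifold R m}
    (reg : set 'rV[R]_k -> ('rV[R]_k -> 'rV[R]_m) -> Prop)
    (iota : N -> M) (r : nat) (E : set (M * 'rV[R]_m)) : Prop :=
  (forall q v, E (q, v) -> range iota q) /\
  forall x0 : N, exists (U : set N) (e : N -> r.-tuple 'rV[R]_m),
    [/\ open_nbhs x0 U,
        U `<=` chart_dom x0 `&` iota @^-1` chart_dom (iota x0),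
        (forall x, U x -> free (e x) /\ fiber E (iota x) = [set` <<e x>>%VS]) &
        forall i, reg (chart x0 @` U) (fun y => let x := chart_inv x0 y in
          transition (iota x) (iota x0) (iota x) (tnth (e x) i))].

Definition invariant_bundle {M : smoothManifold R m} (Phi : smoothFlow M)
    (iota : N -> M) (E : set (M * 'rV[R]_m)) : Prop :=
  forall x t, flow_dom Phi (iota x) t ->
    dmap (Phi t) (iota x) @` fiber E (iota x) = fiber E (Phi t (iota x)).

(* T_(iota x)N as a subspace of T_(iota x)M *)
Definition tangent_space {M : smoothManifold R m} (iota : N -> M) (x : N) :
    set 'rV[R]_m := range (dmap iota x).

(* Lyapunov exponents take finitely many values, so that ereal_sup and
   ereal_inf are a max and a min. *)
Record generalized_relative_NAIM {M : riemannianManifold R m}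
    (Phi : smoothFlow M) (iota : N -> M) (E : set (M * 'rV[R]_m)) : Prop := {
  naim_submanifold : injective_immersion iota ;
  naim_invariant : forall x t, flow_dom Phi (iota x) t ->
    range iota (Phi t (iota x)) ;
  naim_bundle : subbundle (Ck_on 0) iota (m - k) E ;
  naim_bundle_invariant : invariant_bundle Phi iota E ;
  naim_complement : forall x (v : 'rV[R]_m), exists! uw : 'rV[R]_m * 'rV[R]_m,
    [/\ fiber E (iota x) uw.1, tangent_space iota x uw.2 & v = uw.1 + uw.2] ;
  naim_fwd : forall x,
    (ereal_sup (lyap_fwd Phi (iota x) @` fiber E (iota x)) <
     ereal_inf (lyap_fwd Phi (iota x) @` (tangent_space iota x `\ 0%R)))%E ;
  naim_bwd : forall x,
    (ereal_inf (lyap_bwd Phi (iota x) @` (fiber E (iota x) `\ 0%R)) >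
     ereal_sup (lyap_bwd Phi (iota x) @` tangent_space iota x))%E
}.

End bundles.

Section orbits.
Context {R : realType} {m : nat} {M : smoothManifold R m}.
Variable Phi : smoothFlow M.

Definition orbit_of (p : M) : set M := [set Phi t p | t in flow_dom Phi p].

(* The union over t of dPhi^t[E_p] x {Phi^t(p)}, as pairs (point, vector) *)
Definition orbit_bundle (p : M) (Ep : {vspace 'rV[R]_m}) :
    set (M * 'rV[R]_m) :=
  \bigcup_(t in flow_dom Phi p)
    [set (Phi t p, dmap (Phi t) p v) | v in [set` Ep]].

End orbits.

(* Main.v *)
Require Import Defs.
From HB Require Import structures.
From mathcomp Require Import all_boot all_order all_algebra.
From mathcomp Require Import all_classical all_reals all_analysis.
From mathcomp Require Import ring lra.
Import Order.TTheory GRing.Theory Num.Theory.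
Import numFieldNormedType.Exports.
Local Open Scope classical_set_scope.
Local Open Scope ring_scope.

Set Implicit Arguments.
Unset Strict Implicit.
Unset Printing Implicit Defensive.

(** The space E_p is the set of vectors v with lambda+(v) < lambda+(X_p). Since
    lambda+ is ultrametric (growth_exponent_is_exponent), this is a linear
    subspace, X_p is not in it, and by the hypothesis on the basis lambda+(X_p)
    is the largest value of lambda+ on the tangent space.

    Its codimension is 1 (slow_subspace_ex). Suppose that it is at least 2 and
    write L = lambda+(X_p). Then the two largest entries of the tuple of lambda+
    are L. The covectors whose adjoint exponent is at most the second smallest
    adjoint value c form a space of dimension at least 2, so one of them, w, is
    nonzero and vanishes at X_p; thus w is a multiple of the dual of a unit
    vector orthogonal to X_p. The hypothesis gives
    m sigma_P < L + lambda~+(w) <= L + c <= sigma_P. But the pairing of a vector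
    with a covector is constant along the flow, whence lambda~+(w) >= -L
    (lyap_colyap_ge) and sigma_P >= L + c >= 0; as m >= 2, this is absurd.

    Any hyperplane satisfying (a) is contained in E_p, hence equal to it, which
    gives uniqueness. For (b), a nonzero v in E_p is a multiple of X_p plus a
    nonzero vector u orthogonal to X_p. As lambda-(X_p) < lambda-(u), the two
    exponents are different and lambda-(v) = lambda-(u) (lyap_bwd_gap).

    The orbit is made a manifold by taking time as local coordinate. This treats
    closed and non-closed orbits alike: the velocity X_p does not vanish, so
    returns to p are isolated in time (flow_return_isolated) and time is
    injective on short arcs (curve_manifold). Transporting a basis of E_p by the
    flow gives smooth local frames of E (slow_bundle_smooth), being partial
    derivatives of the flow in charts. The fibre of E over a point does not
    depend on the time at which the point is reached, and the inequalities
    between exponents hold along the whole orbit, because exponents are constant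
    along the flow (lyap_fwd_shift, lyap_bwd_shift, orbit_NAIM). *)

(** * Exponential growth rates *)

Section limsup.
Context {R : realType}.

Lemma limf_esup_lt (F : set_system R) (f : R -> \bar R)
    (c : \bar R) :
  Filter F -> (limf_esup f F < c)%E -> \forall t \near F, (f t < c)%E.
Proof.
move=> FF /ereal_inf_lt[_ [A FA <-]] Ac; apply: filterS FA => t At.
by apply: le_lt_trans Ac; apply: ereal_sup_ubound; exists t.
Qed.

Lemma limf_esup_le (F : set_system R) (f : R -> \bar R)
    (c : \bar R) :
  (\forall t \near F, (f t <= c)%E) -> (limf_esup f F <= c)%E.
Proof.
move=> Fc; apply: (@le_trans _ _ (ereal_sup (f @` [set t | (f t <= c)%E]))).
  by apply: ereal_inf_lbound; exists [set t | (f t <= c)%E].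
by apply: ge_ereal_sup => _ [t tc <-].
Qed.

Lemma lee_of_fin_gt (x y : \bar R) :
  (forall c : R, (x < c%:E)%E -> (y <= c%:E)%E) -> (y <= x)%E.
Proof.
move=> xy; rewrite leNgt; apply/negP => lt_xy.
suff [c /andP[xc cy]] : exists c : R, (x < c%:E < y)%E.
  by move: (xy _ xc); rewrite leNgt cy.
case: x y {xy} lt_xy => [x| |] [y| |] //= xy.
- by exists ((x + y) / 2); rewrite !lte_fin midf_lt ?midf_lt //= -lte_fin.
- by exists (x + 1); rewrite lte_fin ltrDl ltr01 ltry.
- by exists (y - 1); rewrite lte_fin ltrBlDr ltrDl ltr01 ltNyr.
- by exists 0; rewrite ltNyr ltry.
Qed.

End limsup.

Section growth.
Context {R : realType} {V : lmodType R}.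

Record is_norm (n : V -> R) : Prop := IsNorm {
  is_norm0 : n 0 = 0 ;
  is_norm_gt0 : forall v, v != 0 -> 0 < n v ;
  is_normZ : forall a v, n (a *: v) = `|a| * n v ;
  is_normD : forall u v, n (u + v) <= n u + n v
}.

Lemma is_norm_ge0 n : is_norm n -> forall v, 0 <= n v.
Proof.
move=> nn v; have [->|/(is_norm_gt0 nn)/ltW //] := eqVneq v 0.
by rewrite is_norm0.
Qed.

(** The inequality for scaling suffices: applied to the inverse scalar it gives
    invariance under nonzero scaling. *)
Record is_exponent (lam : V -> \bar R) : Prop := IsExponent {
  exponent0 : lam 0 = -oo%E ;
  exponentZ_le : forall a v, (lam (a *: v)%R <= lam v)%E ;
  exponentD_le : forall u v, (lam (u + v)%R <= maxe (lam u) (lam v))%E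
}.

(** The common form of the exponents of vectors and of covectors: n0 is the norm
    at time 0 and n t the norm, pulled back to time 0, of the vector transported
    to time t. *)
Definition growth_exponent (F : set_system R) (n0 : V -> R) (n : R -> V -> R)
    (v : V) : \bar R :=
  limf_esup (fun t => if v == 0 then -oo%E
                      else (`|t|^-1 * ln (n t v / n0 v))%:E) F.

Variables (F : set_system R) (n0 : V -> R) (n : R -> V -> R).
Hypotheses (FF : ProperFilter F)
  (Foo : forall A : R, \forall t \near F, A < `|t|)
  (n0norm : is_norm n0) (nnorm : forall t, is_norm (n t)).

Local Notation lam := (growth_exponent F n0 n).

(** With the next lemma, this replaces limits superior of logarithms by bounds
    of the form n t v <= K * exp(c|t|), which are easy to add and multiply. *)
Lemma growth_exponent_bound v c : (lam v < c%:E)%E ->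
  \forall t \near F, n t v <= n0 v * expR (c * `|t|).
Proof.
have [->|v0] := eqVneq v 0.
  by move=> _; apply: nearW => t; rewrite !is_norm0 // mul0r.
move=> /limf_esup_lt; rewrite (negbTE v0) => vc.
apply: filterS2 (Foo 0) vc => t t0; rewrite lte_fin.
rewrite ltr_pdivrMl // [ltRHS]mulrC => /ltW le_ln.
have nv : 0 < n t v / n0 v by rewrite divr_gt0 ?is_norm_gt0.
rewrite -ler_pdivrMl ?is_norm_gt0 // [leLHS]mulrC.
by rewrite -ler_ln ?posrE ?expR_gt0 // expRK.
Qed.

Lemma bound_growth_exponent v K c : 0 < K ->
  (\forall t \near F, n t v <= K * expR (c * `|t|)) -> (lam v <= c%:E)%E.
Proof.
move=> K0 vK; have [->|v0] := eqVneq v 0.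
  by apply: limf_esup_le; apply: nearW => t; rewrite eqxx leNye.
apply: lee_of_fin_gt => c'; rewrite lte_fin -subr_gt0 => cc'.
apply: limf_esup_le; rewrite (negbTE v0).
(* Beyond this time the constant K costs less than the margin c' - c. *)
have := Foo (Num.max 0 (ln (K / n0 v) / (c' - c))).
apply: filterS2 vK => t tK; rewrite gt_max ltr_pdivrMr // => /andP[t0 tbig].
rewrite lee_fin ler_pdivrMl //.
have nv : 0 < n t v / n0 v by rewrite divr_gt0 ?is_norm_gt0.
have Kv : 0 < K / n0 v by rewrite divr_gt0 ?is_norm_gt0.
apply: (@le_trans _ _ (ln (K / n0 v * expR (c * `|t|)))).
  rewrite ler_ln ?posrE // ?(mulr_gt0 Kv) ?expR_gt0 //.
  by rewrite mulrAC ler_pM2r ?invr_gt0 ?is_norm_gt0.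
rewrite lnM ?posrE ?expR_gt0 // expRK.
by move: tbig; rewrite mulrBr; lra.
Qed.

Lemma growth_exponent_is_exponent : is_exponent lam.
Proof.
split=> [|a v|u v].
- apply/eqP; rewrite -leeNy_eq; apply: limf_esup_le.
  by apply: nearW => t; rewrite eqxx.
- apply: lee_of_fin_gt => c /growth_exponent_bound vc.
  have K0 : 0 < `|a| * n0 v + 1.
    by rewrite ltr_wpDl // mulr_ge0 // is_norm_ge0.
  apply: (bound_growth_exponent K0); apply: filterS vc => t tc.
  rewrite is_normZ // mulrDl -mulrA ler_wpDr ?mul1r ?expR_ge0 //.
  by rewrite ler_wpM2l.
- apply: lee_of_fin_gt => c; rewrite gt_max => /andP[].
  move=> /growth_exponent_bound uc /growth_exponent_bound vc.
  have K0 : 0 < n0 u + n0 v + 1.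
    by rewrite ltr_wpDl // addr_ge0 // is_norm_ge0.
  apply: (bound_growth_exponent K0); apply: filterS2 uc vc => t tu tv.
  rewrite (le_trans (is_normD (nnorm t) u v)) // !mulrDl.
  by rewrite ler_wpDr ?mul1r ?expR_ge0 // lerD.
Qed.

End growth.

Section duality.
Context {R : realType} {V W : lmodType R}.
Variables (F : set_system R) (n0 : V -> R) (n : R -> V -> R).
Variables (d0 : W -> R) (d : R -> W -> R).
Hypotheses (FF : ProperFilter F)
  (Foo : forall A : R, \forall t \near F, A < `|t|)
  (n0norm : is_norm n0) (nnorm : forall t, is_norm (n t))
  (d0norm : is_norm d0) (dnorm : forall t, is_norm (d t)).

(** If both exponents were smaller than L and - L with a margin, the product of
    the two norms would decay exponentially, but it stays above a. *)
Lemma growth_exponent_dual v w a L : 0 < a ->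
    (\forall t \near F, a <= d t w * n t v) ->
    (growth_exponent F n0 n v <= L%:E)%E ->
  (- L%:E <= growth_exponent F d0 d w)%E.
Proof.
move=> a0 avw vL; rewrite leNgt; apply/negP => wL.
have [c wc cL] : exists2 c, (growth_exponent F d0 d w < c%:E)%E & c < - L.
  case: (growth_exponent F d0 d w) wL => [x| |] //= xL.
    by exists ((x + - L) / 2); rewrite ?lte_fin midf_lt //= -lte_fin.
  by exists (- L - 1); rewrite ?ltNyr // ltrBlDr ltrDl ltr01.
pose e := (- L - c) / 2; have e0 : 0 < e by rewrite /e; lra.
have vLe : (growth_exponent F n0 n v < (L + e)%:E)%E.
  by apply: le_lt_trans vL _; rewrite lte_fin ltrDl.
pose K := d0 w * n0 v + 1.
have K0 : 0 < K by rewrite ltr_wpDl // mulr_ge0 // is_norm_ge0.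
have := Foo (Num.max 0 ((ln K - ln a) / e)).
have := growth_exponent_bound FF Foo n0norm nnorm vLe.
have := growth_exponent_bound FF Foo d0norm dnorm wc.
move=> dF nF tF; near F => t.
have : Num.max 0 ((ln K - ln a) / e) < `|t| by near: t.
rewrite gt_max => /andP[].
rewrite ltr_pdivrMr // => t0; apply/negP; rewrite -leNgt.
have : a <= K * expR (- e * `|t|).
  have /le_trans : a <= d t w * n t v by near: t.
  apply.
  apply: (@le_trans _ _
    (d0 w * expR (c * `|t|) * (n0 v * expR ((L + e) * `|t|)))).
    by apply: ler_pM; rewrite ?is_norm_ge0 //; near: t.
  rewrite mulrACA -expRD -mulrDl.
  have -> : c + (L + e) = - e by rewrite /e; lra.
  by rewrite ler_wpM2r ?expR_ge0 // lerDl.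
rewrite -ler_ln ?posrE ?mulr_gt0 ?expR_gt0 // lnM ?posrE ?expR_gt0 // expRK.
lra.
Unshelve. all: by end_near. Qed.

End duality.

(** * Values of an exponent and their multiplicities *)

Section subspaces.
Context {K : fieldType} {V : vectType K}.

(** A subspace of maximal dimension among those on which P holds contains every
    vector satisfying P. *)
Lemma vspace_of_closed (P : V -> Prop) :
    P 0 -> (forall a u v, P u -> P v -> P (a *: u + v)) ->
  exists U : {vspace V}, forall v, v \in U <-> P v.
Proof.
move=> P0 PD.
have ex_dim : exists d, `[< exists2 U : {vspace V},
    \dim U = d & forall v, v \in U -> P v >].
  exists 0%N; apply/asboolP; exists 0%VS; first by rewrite dimv0.
  by move=> v; rewrite memv0 => /eqP ->.
have dim_le d : `[< exists2 U : {vspace V},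
    \dim U = d & forall v, v \in U -> P v >] -> (d <= \dim {:V})%N.
  by move=> /asboolP[U <- _]; rewrite dimvS ?subvf.
case: (ex_maxnP ex_dim dim_le) => d /asboolP[U dU UP] dmax.
exists U => v; split=> [/UP //|Pv]; apply: contraT => vU.
have : (\dim (U + <[v]>) <= d)%N.
  apply: dmax; apply/asboolP; exists (U + <[v]>)%VS => // w.
  case/memv_addP => u uU [_ /vlineP[a ->] ->]; rewrite addrC.
  by apply: PD => //; exact: UP.
move=> dim_le_d; have /eqP UE : (U == U + <[v]>)%VS.
  by rewrite eqEdim addvSl dU.
by move: vU; rewrite UE memvE addvSr.
Qed.

End subspaces.

Section exponents.
Context {R : realType} {V : vectType R} {lam : V -> \bar R}.
Hypothesis lamE : is_exponent lam.

Lemma exponentZ a v : a != 0 -> lam (a *: v) = lam v.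
Proof.
move=> a0; apply/le_anti; rewrite (exponentZ_le lamE) /=.
by rewrite -[in leLHS](scalerK a0 v) (exponentZ_le lamE).
Qed.

(** Otherwise v = (u + v) - u would have a smaller exponent than itself. *)
Lemma exponentD_eq u v : (lam u < lam v)%E -> lam (u + v) = lam v.
Proof.
move=> uv; apply/le_anti/andP; split.
  by rewrite (le_trans (exponentD_le lamE u v)) // ge_max (ltW uv) lexx.
rewrite leNgt; apply/negP => uDv.
have := exponentD_le lamE (- 1 *: u) (u + v).
rewrite scaleN1r addKr leNgt gt_max uDv andbT; apply/negP; rewrite negbK.
by rewrite -scaleN1r (le_lt_trans (exponentZ_le lamE _ _)).
Qed.

Lemma exponent_sum_le (c : \bar R) I (r : seq I) (P : pred I) (f : I -> V) :
  (forall i, P i -> (lam (f i) <= c)%E) ->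
  (lam (\sum_(i <- r | P i) f i)%R <= c)%E.
Proof.
move=> fc; elim/big_ind: _ => [|u v uc vc|//].
  by rewrite (exponent0 lamE) leNye.
by rewrite (le_trans (exponentD_le lamE _ _)) // ge_max uc.
Qed.

Lemma exponent_span_le (c : \bar R) (s : seq V) v :
  (forall u, u \in s -> (lam u <= c)%E) -> v \in span s -> (lam v <= c)%E.
Proof.
move=> sc vs; rewrite (@coord_span _ _ _ (in_tuple s) v vs).
apply: exponent_sum_le => i _.
by rewrite (le_trans (exponentZ_le lamE _ _)) // sc // mem_nth.
Qed.

Lemma exponent_span_lt (c : \bar R) (s : seq V) : (-oo < c)%E ->
  (forall u, u \in s -> (lam u < c)%E) ->
  exists2 b, (b < c)%E & forall v, v \in span s -> (lam v <= b)%E.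
Proof.
move=> c0 sc; exists (\big[maxe/-oo%E]_(u <- s) lam u).
  by rewrite big_seq; elim/big_ind: _ => // x y xc yc; rewrite gt_max xc.
move=> v; apply: exponent_span_le => u us.
by rewrite (big_rem u) //= le_max lexx.
Qed.

Lemma exponent_closed_le c a u v :
  (lam u <= c)%E -> (lam v <= c)%E -> (lam (a *: u + v)%R <= c)%E.
Proof.
move=> uc vc; rewrite (le_trans (exponentD_le lamE _ _)) // ge_max vc andbT.
exact: le_trans (exponentZ_le lamE _ _) uc.
Qed.

Lemma exponent_closed_lt c a u v :
  (lam u < c)%E -> (lam v < c)%E -> (lam (a *: u + v)%R < c)%E.
Proof.
move=> uc vc; apply: le_lt_trans (exponentD_le lamE _ _) _.
by rewrite gt_max vc andbT; exact: le_lt_trans (exponentZ_le lamE _ _) uc.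
Qed.

Lemma mem_sublevel c v : (v \in sublevel lam c) = (lam v <= c)%E.
Proof.
have [U UE] : exists U : {vspace V}, forall v, v \in U <-> (lam v <= c)%E.
  apply: vspace_of_closed => [|a u w]; first by rewrite (exponent0 lamE) leNye.
  exact: exponent_closed_le.
rewrite /sublevel; case: xgetP => [W _ WE|/(_ U) //].
by apply/idP/idP => /WE.
Qed.

Lemma sublevelS c c' : (c <= c')%E -> (sublevel lam c <= sublevel lam c')%VS.
Proof.
by move=> cc'; apply/subvP => v; rewrite !mem_sublevel => /le_trans; apply.
Qed.

(** Sublevels of different values have different dimensions. *)
Lemma finite_exponent_values : finite_set (lam @` [set v | v != 0]).
Proof.
set S := lam @` _; pose d (c : \bar R) := \dim (sublevel lam c).
have dS : d @` S `<=` `I_(\dim {:V}).+1.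
  by move=> _ [c _ <-]; rewrite /= ltnS dimvS ?subvf.
have dinj : {in S &, injective d}.
  suff lt_d x y : S x -> S y -> (x < y)%E -> (d x < d y)%N.
    move=> x y /set_mem Sx /set_mem Sy dxy; apply/eqP.
    have [xy|xy|//] := ltgtP x y.
      by have := lt_d _ _ Sx Sy xy; rewrite dxy ltnn.
    by have := lt_d _ _ Sy Sx xy; rewrite dxy ltnn.
  move=> _ [v /= v0 <-] xy; rewrite ltn_neqAle; apply/andP; split; last first.
    by rewrite dimvS // sublevelS // ltW.
  apply/negP => /eqP dxy.
  have /eqP sub_eq : sublevel lam x == sublevel lam (lam v).
    by rewrite eqEdim sublevelS ?(ltW xy) //=; exact: (eq_leq (esym dxy)).
  have : v \in sublevel lam x by rewrite sub_eq mem_sublevel.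
  by rewrite mem_sublevel leNgt xy.
pose g n := xget 0%E [set c | S c /\ d c = n].
apply: (@sub_finite_set _ _ (g @` `I_(\dim {:V}).+1)); last first.
  exact/finite_image/finite_II.
move=> c Sc; exists (d c); first by apply: dS; exists c.
rewrite /g; case: xgetP => [c' _ [Sc' dc']|/(_ c)[]//].
by apply: dinj => //; exact/mem_set.
Qed.

End exponents.


(** The tuple lists each level as often as the dimension jumps there, so its
    entry of index i only appears once the dimension has exceeded i. *)
Lemma nth_repeat_jumps {T : Type} (x0 : T) (s : seq T) (d : T -> nat) d0 i :
    path leq d0 [seq d c | c <- s] ->
    (d0 + i < last d0 [seq d c | c <- s])%N ->
  let jumps := pairmap (fun a b => (b - a)%N) d0 [seq d c | c <- s] in
  (d0 + i < d (nth x0 (flatten [seq nseq cd.2 cd.1 | cd <- zip s jumps]) i))%N.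
Proof.
elim: s d0 i => [|c s IHs] d0 i /=; first by rewrite ltnNge leq_addr.
move=> /andP[d0c sorted_s] i_last; rewrite nth_cat size_nseq nth_nseq.
case: (ltnP i) => [|ci]; first by rewrite ltn_subRL.
have -> : (d0 + i = d c + (i - (d c - d0)))%N.
  by rewrite -[in LHS](subnKC ci) addnA subnKC.
apply: IHs => //.
by rewrite -(subnKC ci) addnA subnKC // in i_last.
Qed.

Section perron.
Context {R : realType} {V : vectType R} {lam : V -> \bar R}.
Hypothesis lamE : is_exponent lam.

(** The dimensions of the sublevels at the successive values are the partial
    sums of the multiplicities. *)
Lemma exponent_tuple_dim i : (i < \dim {:V})%N ->
  (i < \dim (sublevel lam (nth -oo%E (exponent_tuple lam) i)))%N.
Proof.
move=> im; rewrite -[X in (X < _)%N](add0n i).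
set s := exponent_values lam.
have mem_s v : v != 0 -> lam v \in s.
  move=> v0; rewrite mem_sort in_fset_set; last exact: finite_exponent_values.
  by apply/mem_set; exists v.
have sorted_s : sorted <=%O s by exact: sort_le_sorted.
apply: (@nth_repeat_jumps _ _ s (fun c => \dim (sublevel lam c))).
  have : path leq 0 [seq \dim (sublevel lam c) | c <- s].
    case: (s) sorted_s => //= c s'; apply: homo_path => x y.
    by move=> /(sublevelS lamE)/dimvS.
  by [].
have full : (sublevel lam (last -oo%E s) = fullv)%VS.
  apply/eqP; rewrite eqEsubv subvf; apply/subvP => v _.
  rewrite mem_sublevel //; have [->|v0] := eqVneq v 0.
    by rewrite (exponent0 lamE) leNye.
  have vs := mem_s v v0; rewrite -(nth_index -oo%E vs) -nth_last.
  apply: le_sorted_leq_nth => //; rewrite ?inE ?index_mem //.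
    by case: (s) vs.
  by rewrite -index_mem in vs; case: (size s) vs => // k; rewrite ltnS.
rewrite add0n; case: (s) mem_s full => [|c s'] mem_s /=.
  move=> _; suff : (\dim {:V} <= 0)%N by rewrite leqNgt (leq_ltn_trans _ im).
  rewrite leqn0 dimv_eq0; apply/eqP/vspaceP => v; rewrite memv0 memvf.
  by apply/esym/eqP; apply: contraPeq (mem_s v) => v0 /(_ v0); rewrite in_nil.
by move=> full; rewrite (last_map (fun c => \dim (sublevel lam c))) full.
Qed.

Lemma exponent_tuple_ge i (c : \bar R) (U : {vspace V}) :
    (i < \dim {:V})%N -> (\dim U <= i)%N ->
    (forall v, (lam v < c)%E -> v \in U) ->
  (c <= nth -oo%E (exponent_tuple lam) i)%E.
Proof.
move=> im Ui cU; rewrite leNgt; apply/negP => ti.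
have := exponent_tuple_dim im; rewrite ltnNge => /negP; apply.
apply: leq_trans Ui; apply: dimvS; apply/subvP => v.
by rewrite mem_sublevel // => vt; apply: cU; exact: le_lt_trans ti.
Qed.

End perron.

(** * Smoothness in normed spaces *)

Section calculus.
Context {R : realType}.
Implicit Types U V W : normedModType R.

Lemma near_eq_diff V W (f g : V -> W) x :
    (\forall y \near x, f y = g y) -> differentiable f x ->
  differentiable g x /\ 'd g x = 'd f x :> (V -> W).
Proof.
move=> fg df.
have gE : g \o shift x = cst (g x) + 'd f x +o_ (0 : V) id.
  apply/eqaddoP => e e0; have /eqaddoP/(_ e e0) := diff_locally df.
  have : \forall h \near (0 : V), f (h + x) = g (h + x).
    by move: fg; rewrite (near_shift 0) subr0.
  have fgx : f x = g x by exact: (nbhs_singleton fg).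
  by apply: filterS2 => h /=; rewrite !fctE /= fgx => ->.
have dg : 'd g x = 'd f x :> (V -> W).
  by rewrite (diff_unique (diff_continuous df) gE).
split=> //; apply/diff_locallyP; rewrite dg; split=> //.
exact: diff_continuous.
Qed.

Lemma Ck_on_local k V W (A : set V) (f : V -> W) :
  (forall x, A x -> exists2 B, open_nbhs x B & Ck_on k B f) -> Ck_on k A f.
Proof.
elim: k f => [|k IHk] f /=.
  by move=> fA x /fA[B [_ Bx] /(_ x Bx)].
move=> fA; split=> [x /fA[B [_ Bx] [+ _]]|v]; first exact.
by apply: IHk => x /fA[B xB [_ ?]]; exists B.
Qed.

Lemma Ck_on_eq k V W (A : set V) (f g : V -> W) :
  open A -> {in A, f =1 g} -> Ck_on k A f -> Ck_on k A g.
Proof.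
move=> oA; elim: k f g => [|k IHk] f g fg /=.
  move=> fA x Ax; have fgx : \forall y \near x, f y = g y.
    apply: filterS (open_nbhs_nbhs (conj oA Ax)) => y Ay.
    exact/fg/mem_set.
  change (g y @[y --> x] --> g x); rewrite -(nbhs_singleton fgx).
  by apply: cvg_trans (fA x Ax); exact: near_eq_cvg.
have fgn x : A x -> \forall y \near x, f y = g y.
  move=> Ax; apply: filterS (open_nbhs_nbhs (conj oA Ax)) => y Ay.
  exact/fg/mem_set.
move=> [df Df]; split=> [x Ax|v].
  exact: (near_eq_diff (fgn x Ax) (df x Ax)).1.
apply: IHk (Df v) => x /set_mem Ax.
exact: near_eq_derive (fgn x Ax).
Qed.

Lemma Ck_onS k V W (A B : set V) (f : V -> W) :
  A `<=` B -> Ck_on k B f -> Ck_on k A f.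
Proof.
move=> AB; elim: k f => [|k IHk] f /=; first by move=> fB x /AB/fB.
by move=> [df Df]; split=> [x /AB/df|v] //; exact: IHk.
Qed.

Lemma smooth_on_cst V W (A : set V) (a : W) : smooth_on A (fun=> a).
Proof.
move=> k; elim: k a => [|k IHk] a /=; first by move=> x _; exact: cvg_cst.
split=> [x _|v]; first exact: differentiable_cst.
have -> : (fun x => 'D_v (fun=> a) x) = fun=> (0 : W).
  by apply/funext => x; exact: derive_cst.
exact: IHk.
Qed.

(** As the differential L of g does not depend on the point, a directional
    derivative of f o g is again the composite of a directional derivative of f
    with g. *)
Lemma Ck_on_comp_affine k U V W (L : U -> V) (g : U -> V) (A : set V)
    (f : V -> W) :
  (forall y, is_diff y g L) -> open A ->
  Ck_on k A f -> Ck_on k (g @^-1` A) (f \o g).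
Proof.
move=> gL oA; have cg : continuous g.
  by move=> y; apply: differentiable_continuous; exact: ex_diff.
have oB : open (g @^-1` A) by apply: open_comp => // y _; exact: cg.
elim: k f => [|k IHk] f /=.
  by move=> fA y Ay; apply: continuous_comp; [exact: cg|exact: fA].
move=> [df Df]; split=> [y Ay|v].
  by apply: differentiable_comp; [exact: ex_diff|exact: df].
have := IHk _ (Df (L v)); apply: Ck_on_eq => // y /set_mem Ay /=.
have dfy := df _ Ay; have dgy : differentiable g y by exact: ex_diff.
rewrite !deriveE //; last exact: differentiable_comp.
have dgL : 'd g y = L :> (U -> V) by exact: diff_val.
by rewrite (diff_comp dgy dfy) -dgL.
Qed.

Lemma smooth_on_comp_affine U V W (L : U -> V) (g : U -> V) (A : set V)
    (f : V -> W) :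
  (forall y, is_diff y g L) -> open A ->
  smooth_on A f -> smooth_on (g @^-1` A) (f \o g).
Proof. by move=> gL oA fA k; exact: Ck_on_comp_affine gL oA (fA k). Qed.

Lemma smooth_near_differentiable V W (f : V -> W) x :
  smooth_near f x -> differentiable f x.
Proof. by move=> [A [_ Ax] /(_ 1%N)[/(_ x Ax)]]. Qed.

End calculus.

Section affine_maps.
Context {R : realType} {m : nat}.

Lemma is_diff_entry (y : 'rV[R]_1) :
  is_diff y (fun z : 'rV[R]_1 => z 0 0 : R^o) (fun z => z 0 0).
Proof.
have lin : linear (fun z : 'rV[R]_1 => z 0 0 : R^o).
  by move=> a u v; rewrite !mxE.
pose f : {linear 'rV[R]_1 -> R^o} :=
  HB.pack (fun z : 'rV[R]_1 => z 0 0 : R^o)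
    (GRing.isLinear.Build _ _ _ _ _ lin).
have cf : continuous f by move=> z; exact: coord_continuous.
split; first exact: (linear_differentiable y cf).
by have := diff_lin y cf; apply.
Qed.

Lemma is_diff_embed_time (c : 'rV[R]_m) (y : 'rV[R]_1) :
  is_diff y (fun z : 'rV[R]_1 => (z 0 0, c) : R^o * 'rV[R]_m)
            (fun z => (z 0 0, 0)).
Proof. exact: is_diff_pair (is_diff_entry y) (is_diff_cst c y). Qed.

Lemma is_diff_embed_space (t : R) (y : 'rV[R]_m) :
  is_diff y (fun z : 'rV[R]_m => (t, z) : R^o * 'rV[R]_m) (fun z => (0, z)).
Proof. exact: is_diff_pair (is_diff_cst (t : R^o) y) (is_diff_id y). Qed.

End affine_maps.

(** * Differentials of maps and flows on manifolds *)

Section manifold_maps.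
Context {R : realType}.

Lemma chart_dom_near {m} {M : smoothManifold R m} (x q : M) :
  chart_dom q x -> \forall y \near x, chart_dom q y.
Proof.
move=> qx; have [oq _] := chart_dom_nbhs q.
exact: open_nbhs_nbhs (conj oq qx).
Qed.

Lemma chart_dom_refl {m} {M : smoothManifold R m} (x : M) : chart_dom x x.
Proof. by have [] := chart_dom_nbhs x. Qed.

Lemma chart_inv_cvg {m} {M : smoothManifold R m} (q x : M) : chart_dom q x ->
  chart_inv q y @[y --> chart q x] --> x.
Proof.
move=> qx; rewrite -[X in _ --> X](chartK qx).
by apply: chart_inv_continuous; exists x.
Qed.

Lemma chart_inv_near {m} {M : smoothManifold R m} (q x : M) (P : set M) :
  chart_dom q x -> (\forall y \near x, P y) ->
  \forall y \near chart q x, P (chart_inv q y).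
Proof. by move=> qx; exact: (chart_inv_cvg qx). Qed.

Definition manifold_differentiable {m n} {M : smoothManifold R m}
    {N : smoothManifold R n} (f : M -> N) (x : M) : Prop :=
  {for x, continuous f} /\
  differentiable (chart (f x) \o f \o chart_inv x) (chart x x).

(** In charts g o f is the composite of the two chart representations only near
    x, where f takes its values in the domain of the chart around f x. *)
Lemma dmap_comp {m n k} {M : smoothManifold R m} {N : smoothManifold R n}
    {P : smoothManifold R k} (f : M -> N) (g : N -> P) (x : M) :
    manifold_differentiable f x -> manifold_differentiable g (f x) ->
  dmap (g \o f) x = dmap g (f x) \o dmap f x.
Proof.
move=> [cf df] [cg dg]; rewrite /dmap /=.
have fx : (chart (f x) \o f \o chart_inv x) (chart x x) = chart (f x) (f x).
  by rewrite /= chartK //; exact: chart_dom_refl.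
rewrite -fx in dg *; rewrite -(diff_comp df dg).
have fxn : \forall y \near x, chart_dom (f x) (f y).
  by apply: cf; apply: chart_dom_near; exact: chart_dom_refl.
apply: (near_eq_diff _ (differentiable_comp df dg)).2.
apply: filterS (chart_inv_near (chart_dom_refl x) fxn) => y fy /=.
by rewrite chartK.
Qed.

Lemma near_eq_dmap {m n} {M : smoothManifold R m} {N : smoothManifold R n}
    (f g : M -> N) (x : M) :
    manifold_differentiable f x -> (\forall y \near x, f y = g y) ->
  dmap f x = dmap g x.
Proof.
move=> [_ df] fg; have fgx : f x = g x by exact: (nbhs_singleton fg).
rewrite /dmap; rewrite -fgx.
apply/esym/(near_eq_diff _ df).2.
by apply: filterS (chart_inv_near (chart_dom_refl x) fg) => y /= ->.
Qed.

Lemma dmap_id {m} {M : smoothManifold R m} (x : M) :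
  dmap (@id M) x = id :> (_ -> _).
Proof.
have did : differentiable (@id 'rV[R]_m) (chart x x) by exact: ex_diff.
rewrite -[RHS](diff_val (is_diff_def := is_diff_id (chart x x))) /dmap.
apply: (near_eq_diff _ did).2.
have [oq xq] : open_nbhs (chart x x) (chart x @` chart_dom x).
  by split; [exact: chart_image_open|exists x => //; exact: chart_dom_refl].
apply: filterS (open_nbhs_nbhs (conj oq xq)) => _ [y xy <-] /=.
by rewrite chartK.
Qed.

End manifold_maps.

Lemma cvg_pairl {T U : topologicalType} (x : T) (y : U) :
  (z, y) @[z --> x] --> (x, y).
Proof.
apply: (@cvg_pair _ _ _ (nbhs x) (nbhs x) (nbhs y) _ _ _ id (fun=> y)).
  exact: cvg_id.
exact: cvg_cst.
Qed.

Lemma cvg_pairr {T U : topologicalType} (x : T) (y : U) :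
  (x, z) @[z --> y] --> (x, y).
Proof.
apply: (@cvg_pair _ _ _ (nbhs y) (nbhs x) (nbhs y) _ _ _ (fun=> x) id).
  exact: cvg_cst.
exact: cvg_id.
Qed.

Section flow.
Context {R : realType} {m : nat} {M : smoothManifold R m} (Phi : smoothFlow M).
Implicit Types (p : M) (s t : R).

Lemma flow_continuous p t : flow_dom Phi p t -> {for p, continuous (Phi t)}.
Proof.
move=> pt; have [c _] := flow_smooth pt.
have ct : (t, q) @[q --> p] --> (t, p) by exact: cvg_pairr.
exact: (cvg_comp _ _ ct c).
Qed.

Lemma flow_curve_continuous p t : flow_dom Phi p t ->
  {for t, continuous (fun s => Phi s p)}.
Proof.
move=> pt; have [c _] := flow_smooth pt.
have cp : (s, p) @[s --> t] --> (t, p) by exact: cvg_pairl.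
exact: (cvg_comp _ _ cp c).
Qed.

Lemma flow_differentiable p t :
  flow_dom Phi p t -> manifold_differentiable (Phi t) p.
Proof.
move=> pt; split; first exact: flow_continuous.
have [_ /smooth_near_differentiable dF] := flow_smooth pt.
have dg := is_diff_embed_space t (chart p p).
exact: (differentiable_comp (ex_diff (is_diff_def := dg)) dF).
Qed.

Lemma flow_dom_near p t :
  flow_dom Phi p t -> \forall q \near p, flow_dom Phi q t.
Proof.
move=> pt; have tp : nbhs (t, p) [set z : R * M | flow_dom Phi z.2 z.1].
  by apply: open_nbhs_nbhs; split; [exact: flow_dom_open|exact: pt].
have ct : (t, q) @[q --> p] --> (t, p) by exact: cvg_pairr.
exact: (ct _ tp).
Qed.

(** Both sides of the flow equation are defined near p because the domain of the
    flow is open. *)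
Lemma dmap_flowD p s t : flow_dom Phi p s -> flow_dom Phi p (s + t) ->
  dmap (Phi (s + t)) p = dmap (Phi t) (Phi s p) \o dmap (Phi s) p.
Proof.
move=> ps pst; have qt : flow_dom Phi (Phi s p) t by apply/flow_dom_shift.
rewrite -dmap_comp; [|exact: flow_differentiable..].
apply: near_eq_dmap; first exact: flow_differentiable.
apply: filterS2 (flow_dom_near ps) (flow_dom_near pst) => q qs qst /=.
by rewrite flowD.
Qed.

End flow.

Section linear_dmap.
Context {R : realType} {m n : nat} {M : smoothManifold R m}
  {N : smoothManifold R n} (f : M -> N) (x : M).

Lemma dmapD u v : dmap f x (u + v) = dmap f x u + dmap f x v.
Proof. exact: linearD. Qed.

Lemma dmapZ a v : dmap f x (a *: v) = a *: dmap f x v.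
Proof. exact: linearZ. Qed.

Lemma dmap0 : dmap f x 0 = 0.
Proof. exact: linear0. Qed.

Lemma linfun_dmapE v : linfun (dmap f x) v = dmap f x v.
Proof. by rewrite lfunE. Qed.

End linear_dmap.

Section complete_orbit.
Context {R : realType} {m : nat} {M : smoothManifold R m} (Phi : smoothFlow M).
Variable (p : M).
Hypothesis (Dp : flow_dom Phi p = setT).

Lemma flow_dom_full t : flow_dom Phi p t. Proof. by rewrite Dp. Qed.
Hint Resolve flow_dom_full : core.

Lemma flow_dom_orbit t : flow_dom Phi (Phi t p) = setT.
Proof. by apply/seteqP; split=> // s _; apply/flow_dom_shift. Qed.

Lemma flow_add s t : Phi t (Phi s p) = Phi (s + t) p.
Proof. exact: flowD. Qed.

Lemma flow_addNK t : Phi (- t) (Phi t p) = p.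
Proof. by rewrite flow_add (subrr t) flow0. Qed.

Lemma dmap_flow_add s t v :
  dmap (Phi t) (Phi s p) (dmap (Phi s) p v) = dmap (Phi (s + t)) p v.
Proof. by rewrite dmap_flowD. Qed.

Lemma dmap_flow0 v : dmap (Phi 0) p v = v.
Proof.
have dPhi := flow_differentiable (flow_dom0 Phi p).
have near_id : \forall q \near p, Phi 0 q = id q.
  by apply: nearW => q; exact: flow0.
have E := near_eq_dmap dPhi near_id.
by rewrite E dmap_id.
Qed.

Lemma dmap_flowK t v : dmap (Phi (- t)) (Phi t p) (dmap (Phi t) p v) = v.
Proof. by rewrite dmap_flow_add (subrr t) dmap_flow0. Qed.

End complete_orbit.

Section generator.
Context {R : realType} {m : nat} {M : smoothManifold R m} (Phi : smoothFlow M).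
Variables (p : M) (X : M -> 'rV[R]_m).
Hypotheses (Dp : flow_dom Phi p = setT) (Xgen : is_generator Phi X).

Lemma dmap_flowVK t v : dmap (Phi t) p (dmap (Phi (- t)) (Phi t p) v) = v.
Proof.
have := dmap_flowK (flow_dom_orbit Dp t) (- t) v.
by rewrite (opprK t) flow_addNK.
Qed.

Lemma dmap_flow_inj t : injective (dmap (Phi t) p).
Proof. exact: can_inj (dmap_flowK Dp t). Qed.

Lemma dmap_flow_eq0 t v : (dmap (Phi t) p v == 0) = (v == 0).
Proof. by rewrite -[RHS](inj_eq (@dmap_flow_inj t)) dmap0. Qed.

Lemma flow_curve_diff q :
  differentiable (fun t : R => chart q (Phi t q)) (0 : R) /\
  'd (fun t : R => chart q (Phi t q)) (0 : R) 1 = X q.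
Proof.
have [der val] := Xgen q.
have df : differentiable (fun t : R => chart q (Phi t q)) (0 : R).
  exact/derivable1_diffP.
by split=> //; rewrite -deriveE.
Qed.

(** The generator is carried along by the flow because flowing for time t
    commutes with flowing for a short time. *)
Lemma dmap_flow_generator t : dmap (Phi t) p (X p) = X (Phi t p).
Proof.
pose F := chart (Phi t p) \o Phi t \o chart_inv p.
pose c (s : R) : 'rV[R]_m := chart p (Phi s p).
have [_ dF] : manifold_differentiable (Phi t) p.
  by apply: flow_differentiable; exact: flow_dom_full.
have [dc cX] := flow_curve_diff p.
have [dc' cX'] := flow_curve_diff (Phi t p).
have c0 : c 0 = chart p p by rewrite /c flow0.
have dF0 : differentiable F (c 0) by rewrite c0.
have dFc := differentiable_comp dc dF0.
have Fc : \forall s \near (0 : R),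
    (F \o c) s = chart (Phi t p) (Phi s (Phi t p)).
  have pn : \forall s \near (0 : R), chart_dom p (Phi s p).
    have cc := flow_curve_continuous (flow_dom0 Phi p).
    by apply: cc; rewrite flow0; apply: chart_dom_near; exact: chart_dom_refl.
  apply: filterS pn => s ps.
  by rewrite /F /c /= chartK // !flow_add // addrC.
have [_ E] := near_eq_diff Fc dFc.
rewrite -cX' E (diff_comp dc dF0) /=.
by rewrite cX /dmap -c0.
Qed.

End generator.

(** * Norms on tangent and cotangent spaces *)

Section metric_space.
Context {R : realType} {m : nat} {M : riemannianManifold R m} (q : M).
Local Notation "<| u , v |>" := (metric q u v) (format "<| u ,  v |>").
Local Notation n := (tnorm q).

Lemma metricP u a v w : <|u, a *: v + w|> = a * <|u, v|> + <|u, w|>.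
Proof. exact: metric_linear. Qed.

Lemma metricDr u v w : <|u, v + w|> = <|u, v|> + <|u, w|>.
Proof. by have := metricP u 1 v w; rewrite scale1r mul1r. Qed.

Lemma metric0r u : <|u, 0|> = 0.
Proof. by apply: (addrI <|u, 0|>); rewrite -metricDr !addr0. Qed.

Lemma metricZr u a v : <|u, a *: v|> = a * <|u, v|>.
Proof. by rewrite -[a *: v]addr0 metricP metric0r addr0. Qed.

Lemma metricDl u v w : <|u + v, w|> = <|u, w|> + <|v, w|>.
Proof. by rewrite Defs.metric_sym metricDr !(Defs.metric_sym q w). Qed.

Lemma metricZl u a v : <|a *: u, v|> = a * <|u, v|>.
Proof. by rewrite Defs.metric_sym metricZr (Defs.metric_sym q v). Qed.

Lemma metric_ge0 u : 0 <= <|u, u|>.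
Proof.
by have [->|/metric_pos/ltW //] := eqVneq u 0; rewrite metric0r.
Qed.

Lemma sqr_tnorm u : n u ^+ 2 = <|u, u|>.
Proof. by rewrite sqr_sqrtr ?metric_ge0. Qed.

Lemma tnorm_ge0 u : 0 <= n u. Proof. exact: sqrtr_ge0. Qed.

Lemma tnorm_gt0 u : u != 0 -> 0 < n u.
Proof. by move=> u0; rewrite sqrtr_gt0 metric_pos. Qed.

Lemma tnormZ a u : n (a *: u) = `|a| * n u.
Proof.
by rewrite /tnorm metricZl metricZr mulrA -expr2 sqrtrM ?sqr_ge0 // sqrtr_sqr.
Qed.

Lemma metric_le_tnorm u v : `|<|u, v|>| <= n u * n v.
Proof.
have [->|v0] := eqVneq v 0.
  by rewrite metric0r normr0 mulr_ge0 ?tnorm_ge0.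
have vv := metric_pos q v0.
rewrite -(@ler_pXn2r _ 2) ?nnegrE ?mulr_ge0 ?tnorm_ge0 //.
rewrite exprMn !sqr_tnorm real_normK ?num_real //.
(* The squared norm of the component of u orthogonal to v is nonnegative. *)
have := metric_ge0 (u + (- (<|u, v|> / <|v, v|>)) *: v).
rewrite metricDl !metricDr metricZl !metricZr (Defs.metric_sym q v u) metricZl.
set a := <|u, v|>; set b := <|v, v|> in vv *; set c := <|u, u|>.
have -> : c + - (a / b) * a + (- (a / b) * a + - (a / b) * (- (a / b) * b)) =
    c - a ^+ 2 / b by field; rewrite gt_eqF.
by rewrite subr_ge0 ler_pdivrMr.
Qed.

Lemma tnorm_is_norm : is_norm n.
Proof.
split=> [|v /tnorm_gt0 //|a v|u v].
- by rewrite /tnorm metric0r sqrtr0.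
- exact: tnormZ.
rewrite -(@ler_pXn2r _ 2) ?nnegrE ?addr_ge0 ?tnorm_ge0 // sqrrD !sqr_tnorm.
rewrite metricDl !metricDr (Defs.metric_sym q v u).
have := le_trans (ler_norm _) (metric_le_tnorm u v).
by rewrite mulr2n; lra.
Qed.

Lemma flatE u v : flat q u v = <|u, v|>.
Proof.
have lin : linear (metric q u : 'rV[R]_m -> R^o).
  by move=> a v' w; rewrite metricP.
pose f : {linear 'rV[R]_m -> R^o} :=
  HB.pack (metric q u : 'rV[R]_m -> R^o) (GRing.isLinear.Build _ _ _ _ _ lin).
exact: (lfunE f v).
Qed.

Lemma flatZ a u : flat q (a *: u) = a *: flat q u.
Proof.
by apply/lfunP => v; rewrite lfunE /= !flatE metricZl.
Qed.

Lemma flat_lin : linear (flat q).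
Proof.
move=> a u v; apply/lfunP => w.
by rewrite !lfunE /= lfunE /= !flatE metricDl metricZl.
Qed.

(** Riesz representation: the metric being nondegenerate, flat is injective,
    hence bijective between spaces of the same finite dimension. *)
Lemma flat_surj w : exists u, w = flat q u.
Proof.
pose f : {linear 'rV[R]_m -> 'Hom('rV[R]_m, R^o)} :=
  HB.pack (flat q) (GRing.isLinear.Build _ _ _ _ _ flat_lin).
have finj : lker (linfun f) == 0%VS.
  apply/lker0P => u v; rewrite !lfunE /= => /lfunP/(_ (u - v)).
  rewrite !flatE => uv; apply/eqP; rewrite -subr_eq0; apply: contraT.
  move=> /(metric_pos q); rewrite -[X in <|X, _|>]scale1r.
  rewrite -scaleN1r scale1r metricDl metricZl scaleN1r uv mulN1r subrr.
  by rewrite ltxx.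
have : w \in limg (linfun f).
  suff -> : limg (linfun f) = fullv by rewrite memvf.
  apply/eqP; rewrite eqEdim subvf limg_dim_eq; last by rewrite (eqP finj) capv0.
  by rewrite !dimvf /=; exact: eq_leq (muln1 (1 * m)).
by case/memv_imgP => u _ ->; exists u; rewrite lfunE.
Qed.

Lemma unit_normal_normalize x u : u != 0 -> <|u, x|> = 0 ->
  unit_normal q x ((n u)^-1 *: u).
Proof.
move=> u0 ux; split; last by rewrite metricZl ux mulr0.
have nu := tnorm_gt0 u0.
by rewrite /unit_tangent /= tnormZ gtr0_norm ?invr_gt0 // mulVf ?gt_eqF.
Qed.

Lemma conorm_flat u : conorm q (flat q u) = n u.
Proof.
rewrite /conorm; set S := [set _ | _ in _].
have Sn : ubound S (n u).
  move=> _ [v /= nv <-]; rewrite flatE.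
  by apply: le_trans (metric_le_tnorm _ _) _; rewrite nv mulr1.
have [u0|u0] := eqVneq u 0; last first.
  have nu := tnorm_gt0 u0.
  have Su : S (n u).
    exists ((n u)^-1 *: u).
      by rewrite /unit_tangent /= tnormZ gtr0_norm ?invr_gt0 // mulVf ?gt_eqF.
    rewrite flatE metricZr -sqr_tnorm expr2 mulKf ?gt_eqF //.
    by rewrite gtr0_norm.
  apply/le_anti/andP; split; first by apply: ge_sup => //; exists (n u).
  by apply: ub_le_sup => //; exists (n u).
have n0 : n u = 0 by rewrite u0 /tnorm metric0r sqrtr0.
have [[z Sz]|S0] := pselect (exists z, S z); last first.
  rewrite (_ : S = set0) ?sup0 ?n0 //.
  by apply/seteqP; split=> // x Sx; apply: S0; exists x.
apply/le_anti/andP; split.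
  by apply: ge_sup => //; exists z.
have zS : z <= sup S by apply: ub_le_sup Sz; exists (n u).
by rewrite n0; apply: le_trans zS; case: Sz => v _ <-.
Qed.

Lemma flat_eq0 u : (flat q u == 0) = (u == 0).
Proof.
apply/eqP/eqP => [/lfunP/(_ u)|->]; last first.
  by apply/lfunP => v; rewrite flatE lfunE /= Defs.metric_sym metric0r.
rewrite flatE lfunE /=; apply: contra_eq => /(metric_pos q) uu.
by rewrite gt_eqF.
Qed.

Lemma conorm_is_norm : is_norm (conorm q).
Proof.
split=> [|w|a w|w w'].
- have -> : 0 = flat q 0 by apply/esym/eqP; rewrite flat_eq0.
  by rewrite conorm_flat /tnorm metric0r sqrtr0.
- by have [u ->] := flat_surj w; rewrite flat_eq0 conorm_flat; exact: tnorm_gt0.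
- by have [u ->] := flat_surj w; rewrite -flatZ !conorm_flat tnormZ.
- have [u ->] := flat_surj w; have [v ->] := flat_surj w'.
  have -> : flat q u + flat q v = flat q (u + v).
    by have := flat_lin 1 u v; rewrite !scale1r.
  by rewrite !conorm_flat; exact: (is_normD tnorm_is_norm).
Qed.

Lemma covector_le_conorm (w : 'Hom('rV[R]_m, R^o)) v :
  `|w v| <= conorm q w * n v.
Proof.
have [u ->] := flat_surj w; rewrite conorm_flat flatE.
exact: metric_le_tnorm.
Qed.

End metric_space.

(** * Lyapunov exponents along a complete orbit *)

Section flow_exponents.
Context {R : realType} {m : nat} {M : riemannianManifold R m}
  (Phi : smoothFlow M).
Variable (p : M).
Hypothesis (Dp : flow_dom Phi p = setT).

Definition pushed_tnorm t v := tnorm (Phi t p) (dmap (Phi t) p v).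
Definition pushed_conorm t w := conorm (Phi t p) (copush Phi p t w).

Lemma pushed_tnorm_is_norm t : is_norm (pushed_tnorm t).
Proof.
have nn := @tnorm_is_norm _ _ M (Phi t p); rewrite /pushed_tnorm.
split=> [|v v0|a v|u v].
- by rewrite dmap0 (is_norm0 nn).
- by rewrite (is_norm_gt0 nn) // dmap_flow_eq0.
- by rewrite dmapZ (is_normZ nn).
- by rewrite dmapD (is_normD nn).
Qed.

Lemma copush_pairing t (w : 'Hom('rV[R]_m, R^o)) v :
  copush Phi p t w (dmap (Phi t) p v) = w v.
Proof. by rewrite lfunE /= linfun_dmapE dmap_flowK. Qed.

Lemma pushed_conorm_is_norm t : is_norm (pushed_conorm t).
Proof.
have nn := @conorm_is_norm _ _ M (Phi t p); rewrite /pushed_conorm.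
split=> [|w w0|a w|u v].
- by rewrite /copush comp_lfun0l (is_norm0 nn).
- rewrite (is_norm_gt0 nn) //; apply: contra_neq w0 => cw.
  by apply/lfunP => v; rewrite -(copush_pairing t w) cw !lfunE.
- by rewrite /copush -comp_lfunZl (is_normZ nn).
- by rewrite /copush comp_lfunDl (is_normD nn).
Qed.

Lemma to_sup_proper : ProperFilter (to_sup (flow_dom Phi p)).
Proof.
rewrite Dp; apply: filter_from_proper; last first.
  by move=> a _; exists (a + 1); split=> //; rewrite ltrDl.
apply: filter_from_filter; first by exists 0.
move=> a b _ _; exists (Num.max a b) => // t /= [_].
by rewrite gt_max => /andP[].
Qed.

Lemma to_inf_proper : ProperFilter (to_inf (flow_dom Phi p)).
Proof.
rewrite Dp; apply: filter_from_proper; last first.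
  by move=> a _; exists (a - 1); split=> //; rewrite gtrBl.
apply: filter_from_filter; first by exists 0.
move=> a b _ _; exists (Num.min a b) => // t /= [_].
by rewrite lt_min => /andP[].
Qed.

Lemma to_sup_infty (A : R) : \forall t \near to_sup (flow_dom Phi p), A < `|t|.
Proof.
by rewrite Dp; exists A => // t [_ At]; exact: lt_le_trans At (ler_norm _).
Qed.

Lemma to_inf_infty (A : R) : \forall t \near to_inf (flow_dom Phi p), A < `|t|.
Proof.
rewrite Dp; exists (- A) => // t [_]; rewrite ltrNr => At.
by apply: lt_le_trans At _; rewrite -normrN ler_norm.
Qed.

Lemma lyap_fwdE : lyap_fwd Phi p =
  growth_exponent (to_sup (flow_dom Phi p)) (tnorm p) pushed_tnorm.
Proof. by []. Qed.

Lemma lyap_bwdE : lyap_bwd Phi p =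
  growth_exponent (to_inf (flow_dom Phi p)) (tnorm p) pushed_tnorm.
Proof. by []. Qed.

Lemma colyap_fwdE : colyap_fwd Phi p =
  growth_exponent (to_sup (flow_dom Phi p)) (conorm p) pushed_conorm.
Proof. by []. Qed.

Lemma lyap_fwd_exponent : is_exponent (lyap_fwd Phi p).
Proof.
rewrite lyap_fwdE; apply: growth_exponent_is_exponent.
- exact: to_sup_proper.
- exact: to_sup_infty.
- exact: tnorm_is_norm.
- exact: pushed_tnorm_is_norm.
Qed.

Lemma lyap_bwd_exponent : is_exponent (lyap_bwd Phi p).
Proof.
rewrite lyap_bwdE; apply: growth_exponent_is_exponent.
- exact: to_inf_proper.
- exact: to_inf_infty.
- exact: tnorm_is_norm.
- exact: pushed_tnorm_is_norm.
Qed.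

Lemma colyap_fwd_exponent : is_exponent (colyap_fwd Phi p).
Proof.
rewrite colyap_fwdE; apply: growth_exponent_is_exponent.
- exact: to_sup_proper.
- exact: to_sup_infty.
- exact: conorm_is_norm.
- exact: pushed_conorm_is_norm.
Qed.

(** The pairing of the transported covector with the transported vector is
    constant in time. *)
Lemma lyap_colyap_ge (v : 'rV[R]_m) (w : 'Hom('rV[R]_m, R^o)) (L : R) :
    w v != 0 -> (lyap_fwd Phi p v <= L%:E)%E ->
  (- L%:E <= colyap_fwd Phi p w)%E.
Proof.
move=> wv vL; have wv0 : 0 < `|w v| by rewrite normr_gt0.
rewrite colyap_fwdE.
apply: (growth_exponent_dual (to_sup_proper) (@to_sup_infty) (tnorm_is_norm _)
  pushed_tnorm_is_norm (conorm_is_norm _) pushed_conorm_is_norm wv0 _ vL).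
have FF := to_sup_proper.
apply: nearW => t; rewrite -(copush_pairing t w).
exact: covector_le_conorm.
Qed.

End flow_exponents.

(** An infinite sum of t and t' would make sg, hence the left side of the strict
    inequality, infinite. Otherwise 0 <= L + t' <= sg, and m * sg < L + t' <= sg
    is impossible for m >= 2. *)
Lemma perron_gap_contradiction {R : realType} (m : nat) (sg t t' I L : \bar R) :
    (1 < m)%N -> (L <= t)%E -> (forall r : R, L = r%:E -> (- r%:E <= t')%E) ->
    (dual_adde t t' <= sg)%E -> (I <= t')%E ->
  ~ (dual_adde (m%:R%:E * sg) (- I) < L)%E.
Proof.
move=> m1; have m0 : 0 < m%:R :> R by rewrite ltr0n ltnW.
have sg_fin : (dual_adde (m%:R%:E * +oo) (- I) < L)%E -> False.
  by rewrite gt0_muley ?lte_fin // /dual_adde ltNge leey.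
case: L sg_fin => [l| |] sg_fin; last by move=> _ _ _ _; rewrite ltNge leNye.
  move=> lt /(_ _ erefl) lt' tsg It' sgL.
  case: sg tsg sgL => [s| |] // tsg sgL; last first.
    by case: t lt tsg => [r| |] //; case: t' lt' {It'} => [r'| |].
  case: t t' lt lt' tsg It' => [r| |] [r'| |] //.
  rewrite /dual_adde /= !lee_fin => lr lr' rs ir'.
  case: I sgL ir' {sg_fin} => [i| |] //.
  rewrite /dual_adde /= lte_fin lee_fin => sgL ir'.
  have s0 : 0 <= s by lra.
  have : 2 * s <= m%:R * s by rewrite ler_wpM2r // ler_nat.
  lra.
by rewrite leye_eq => /eqP -> _ + _; case: t' => [r'| |]; case: sg sg_fin.
Qed.

Section slow_subspace.
Context {R : realType} {m : nat} {M : riemannianManifold R m}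
  (Phi : smoothFlow M).
Variables (p : M) (x : 'rV[R]_m).
Hypothesis (Dp : flow_dom Phi p = setT).

Local Notation lam := (lyap_fwd Phi p).
Local Notation colam := (colyap_fwd Phi p).

(** The covectors vanishing at x form a hyperplane, which a plane intersects. *)
Lemma covector_annihilating (S : {vspace 'Hom('rV[R]_m, R^o)}) :
  (1 < \dim S)%N -> exists w, [/\ w \in S, w != 0 & w x = 0].
Proof.
move=> S2; pose w1 := vpick S.
have w1S : w1 \in S by exact: memv_pick.
have w10 : w1 != 0.
  by rewrite vpick0 -dimv_eq0 -lt0n (ltn_trans _ S2).
have [w1x|w1x] := eqVneq (w1 x) 0; first by exists w1.
have [w2 w2S w2w1] : exists2 w2, w2 \in S & w2 \notin <[w1]>%VS.
  apply/subvPn; apply: contraTN S2 => /dimvS.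
  by rewrite dim_vline w10 -leqNgt.
exists (w2 - (w2 x / w1 x) *: w1); split.
- by rewrite memvB // memvZ.
- by apply: contra w2w1; rewrite subr_eq0 => /eqP ->; rewrite memvZ ?memv_line.
- by rewrite add_lfunE opp_lfunE scale_lfunE [_ *: _]divfK // subrr.
Qed.

Lemma colyap_unit_normal (w : 'Hom('rV[R]_m, R^o)) : w != 0 -> w x = 0 ->
  (ereal_inf [set colam (flat p u) | u in unit_normal p x] <= colam w)%E.
Proof.
have [u ->] := flat_surj p w; rewrite flat_eq0 flatE => u0 ux.
have nu := tnorm_gt0 p u0; have nu0 : (tnorm p u)^-1 != 0.
  by rewrite invr_eq0 gt_eqF.
rewrite -(exponentZ (colyap_fwd_exponent Dp) _ nu0) -flatZ.
apply: ereal_inf_lbound; exists ((tnorm p u)^-1 *: u) => //.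
exact: unit_normal_normalize.
Qed.

Hypothesis Hfwd :
  (dual_adde (m%:R%:E * perron_coef m lam colam)
     (- ereal_inf [set colam (flat p u) | u in unit_normal p x]) < lam x)%E.
Hypothesis lam_max : forall v, (lam v <= lam x)%E.

Lemma lam_gtNy : (-oo < lam x)%E.
Proof. by apply: le_lt_trans Hfwd; rewrite leNye. Qed.

(** If the codimension were at least 2, the two largest values of the forward
    exponent would both be that of x. A covector w that vanishes at x can be
    found among those with the two smallest adjoint exponents, and its adjoint
    exponent is then at most sigma_P minus the exponent of x, against the
    hypothesis on covectors dual to unit normals. *)
Lemma slow_subspace_ex : exists E : {vspace 'rV[R]_m},
  (forall v, v \in E <-> (lam v < lam x)%E) /\ (\dim E).+1 = m.
Proof.
have lamE := lyap_fwd_exponent Dp; have colamE := colyap_fwd_exponent Dp.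
have [E EP] : exists E : {vspace 'rV[R]_m},
    forall v, v \in E <-> (lam v < lam x)%E.
  apply: vspace_of_closed; first by rewrite (exponent0 lamE) lam_gtNy.
  by move=> a u v; exact: exponent_closed_lt.
exists E; split=> //.
have dimV : \dim {:'rV[R]_m} = m by rewrite dimvf /= /dim /= mul1n.
have dimW : \dim {:'Hom('rV[R]_m, R^o)} = m 
  by rewrite dimvf; exact: etrans (muln1 (1 * m)) (mul1n m).
have xE : x \notin E by apply/negP => /EP; rewrite ltxx.
have ltEm : (\dim E < m)%N.
  have leEm : (\dim E <= m)%N by rewrite -[leqRHS]dimV dimvS ?subvf.
  rewrite ltn_neqAle leEm andbT; apply: contra xE => /eqP dimE.
  suff /eqP -> : E == fullv by rewrite memvf.
  by rewrite eqEdim subvf dimV dimE /=.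
apply/eqP; rewrite eqn_leq ltEm leqNgt /=; apply/negP => ltE.
have m1 : (1 < m)%N by exact: leq_trans ltE.
have im : (m - 2 < m)%N by rewrite ltn_subrL (ltnW m1).
(* Counting from 0, i is the second largest index and rev_ord i = 1. *)
pose i := Ordinal im.
have rev_i : rev_ord i = 1%N :> nat by rewrite /= subnS subKn.
set t' := nth -oo%E (exponent_tuple colam) (rev_ord i).
have [w [wS w0 wx]] : exists w, [/\ w \in sublevel colam t', w != 0 & w x = 0].
  apply: covector_annihilating.
  have := @exponent_tuple_dim _ _ _ colamE (rev_ord i).
  by rewrite -/t' rev_i dimW => ->.
have wt : (colam w <= t')%E by rewrite -mem_sublevel.
have [v wv] : exists v, w v != 0.
  apply: contrapT => w00; move/eqP: w0; apply; apply/lfunP => v.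
  rewrite lfunE /=.
  by apply/eqP; apply: contrapT => /negP wv; apply: w00; exists v.
have := Hfwd; apply: (@perron_gap_contradiction _ _ _
  (nth -oo%E (exponent_tuple lam) i) t').
- exact: m1.
- apply: (exponent_tuple_ge lamE (U := E)); first by rewrite dimV.
    by rewrite -ltnS /= -subSn // ltn_subRL.
  by move=> u /EP.
- move=> r Lr; apply: le_trans wt; apply: lyap_colyap_ge wv _ => //.
  by rewrite -Lr.
- exact: (le_bigmax_cond _ (fun i : 'I_m => dual_adde _ _)).
- by apply: le_trans wt; exact: colyap_unit_normal.
Qed.

End slow_subspace.

Section shift.
Context {R : realType} {m : nat} {M : riemannianManifold R m}
  (Phi : smoothFlow M).

(** A shift of time changes |t| by at most |s|: this costs a constant factor. *)
Lemma growth_shift_le p s v (F F' : set_system R) :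
    flow_dom Phi p = setT -> ProperFilter F -> ProperFilter F' ->
    (forall A : R, \forall t \near F, A < `|t|) ->
    (forall A : R, \forall t \near F', A < `|t|) ->
    (forall P : set R, F P -> F' [set t | P (s + t)]) ->
  (growth_exponent F' (tnorm (Phi s p)) (pushed_tnorm Phi (Phi s p))
      (dmap (Phi s) p v) <=
   growth_exponent F (tnorm p) (pushed_tnorm Phi p) v)%E.
Proof.
move=> Dp FF FF' Foo F'oo shift; have Dq := flow_dom_orbit Dp s.
apply: lee_of_fin_gt => c vc.
have := growth_exponent_bound FF Foo (tnorm_is_norm p)
  (pushed_tnorm_is_norm Dp) vc.
move=> /shift vb; set K := (tnorm p v + 1) * expR (`|c| * `|s|).
have K0 : 0 < K by rewrite mulr_gt0 ?expR_gt0 // ltr_wpDl ?tnorm_ge0.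
apply: (bound_growth_exponent FF' F'oo (tnorm_is_norm _)
  (pushed_tnorm_is_norm Dq) K0).
apply: filterS vb => t /=; rewrite /pushed_tnorm dmap_flow_add // flow_add //.
move=> /le_trans; apply; rewrite /K -mulrA -expRD.
apply: ler_pM; rewrite ?tnorm_ge0 ?expR_ge0 ?lerDl // ler_expR.
rewrite -lerBlDr -mulrBr; apply: le_trans (ler_norm _) _; rewrite normrM.
by rewrite ler_wpM2l //; have := ler_dist_dist (s + t) t; rewrite addrK.
Qed.

Lemma lyap_fwd_shift p s v : flow_dom Phi p = setT ->
  lyap_fwd Phi (Phi s p) (dmap (Phi s) p v) = lyap_fwd Phi p v.
Proof.
move=> Dp; have Dq := flow_dom_orbit Dp s.
suff le q r u : flow_dom Phi q = setT ->
    (lyap_fwd Phi (Phi r q) (dmap (Phi r) q u) <= lyap_fwd Phi q u)%E.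
  apply/le_anti/andP; split; first exact: (le p s v Dp).
  by have := le (Phi s p) (- s) (dmap (Phi s) p v) Dq;
    rewrite (dmap_flowK Dp) (flow_addNK Dp).
move=> Dr; rewrite !lyap_fwdE; apply: growth_shift_le => //.
- exact: to_sup_proper.
- by apply: to_sup_proper; exact: flow_dom_orbit.
- exact: to_sup_infty.
- by apply: to_sup_infty; exact: flow_dom_orbit.
move=> P; rewrite flow_dom_orbit // Dr => -[a _ aP].
by exists (a - r) => // t [_ at_]; apply: aP; split=> //; rewrite -ltrBlDl.
Qed.

Lemma lyap_bwd_shift p s v : flow_dom Phi p = setT ->
  lyap_bwd Phi (Phi s p) (dmap (Phi s) p v) = lyap_bwd Phi p v.
Proof.
move=> Dp; have Dq := flow_dom_orbit Dp s.
suff le q r u : flow_dom Phi q = setT ->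
    (lyap_bwd Phi (Phi r q) (dmap (Phi r) q u) <= lyap_bwd Phi q u)%E.
  apply/le_anti/andP; split; first exact: (le p s v Dp).
  by have := le (Phi s p) (- s) (dmap (Phi s) p v) Dq;
    rewrite (dmap_flowK Dp) (flow_addNK Dp).
move=> Dr; rewrite !lyap_bwdE; apply: growth_shift_le => //.
- exact: to_inf_proper.
- by apply: to_inf_proper; exact: flow_dom_orbit.
- exact: to_inf_infty.
- by apply: to_inf_infty; exact: flow_dom_orbit.
move=> P; rewrite flow_dom_orbit // Dr => -[a _ aP].
by exists (a - r) => // t [_ at_]; apply: aP; split=> //; rewrite -ltrBrDl.
Qed.

End shift.

Section gaps.
Context {R : realType} {m : nat} {M : riemannianManifold R m}
  (Phi : smoothFlow M).
Variables (p : M) (x : 'rV[R]_m).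
Hypotheses (Dp : flow_dom Phi p = setT) (x0 : x != 0).

Lemma lyap_fwd_gap (F : {vspace 'rV[R]_m}) : (-oo < lyap_fwd Phi p x)%E ->
    (forall v, v \in F -> (lyap_fwd Phi p v < lyap_fwd Phi p x)%E) ->
  (ereal_sup (lyap_fwd Phi p @` [set` F]) < lyap_fwd Phi p x)%E.
Proof.
move=> xNy Fx; have lamE := lyap_fwd_exponent Dp.
have [|b bx Fb] := exponent_span_lt lamE (s := vbasis F) xNy.
  by move=> u /vbasis_mem/Fx.
apply: le_lt_trans bx; apply: ge_ereal_sup => _ [v /= vF <-].
by apply: Fb; rewrite (span_basis (vbasisP F)).
Qed.

(** A nonzero v in F is a multiple of x plus a nonzero normal u, and u dominates
    because its backward exponent is larger than that of x. *)
Lemma lyap_bwd_gap (F : {vspace 'rV[R]_m}) : x \notin F ->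
    (lyap_bwd Phi p x < ereal_inf (lyap_bwd Phi p @` unit_normal p x))%E ->
  (lyap_bwd Phi p x < ereal_inf (lyap_bwd Phi p @` ([set` F] `\ 0%R)))%E.
Proof.
move=> xF gap; have lamE := lyap_bwd_exponent Dp.
apply: (lt_le_trans gap); apply: le_ereal_inf_tmp => _ [v [/= vF /eqP v0] <-].
set a := metric p x v / metric p x x; pose u := v - a *: x.
have xx : metric p x x != 0 by rewrite gt_eqF ?metric_pos.
have ux : metric p u x = 0.
  rewrite metricDl -scaleNr metricZl (Defs.metric_sym p v) /a.
  by rewrite mulNr divfK // subrr.
have vE : v = a *: x + u by rewrite /u addrC subrK.
have u0 : u != 0.
  apply: contra_neq v0 => u0; move: vF; rewrite vE u0 addr0.
  have [->|a0] := eqVneq a 0; first by rewrite scale0r.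
  by rewrite rpredZeq (negbTE a0) (negbTE xF).
have nu := tnorm_gt0 p u0; have nu0 : (tnorm p u)^-1 != 0.
  by rewrite invr_eq0 gt_eqF.
have infu :
    (ereal_inf (lyap_bwd Phi p @` unit_normal p x) <= lyap_bwd Phi p u)%E.
  rewrite -(exponentZ lamE _ nu0); apply: ereal_inf_lbound.
  exists ((tnorm p u)^-1 *: u) => //; exact: unit_normal_normalize.
rewrite vE (exponentD_eq lamE) //.
apply: le_lt_trans (exponentZ_le lamE _ _) _; exact: lt_le_trans gap infu.
Qed.

End gaps.

(** * The range of a locally injective curve as a manifold *)

(** A copy of T that carries the finest topology for which g is continuous. *)
Definition coinduced {R : realType} {T : choiceType} (g : R -> T) : Type := T.

Section coinduced_topology.
Context {R : realType} {T : choiceType} (g : R -> T).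

HB.instance Definition _ := Choice.on (coinduced g).

Definition coinduced_open : set_system (coinduced g) :=
  [set A | open (g @^-1` A)].

Lemma coinduced_openT : coinduced_open setT.
Proof. exact: openT. Qed.

Lemma coinduced_openI : setI_closed coinduced_open.
Proof. by move=> A B oA oB; exact: openI. Qed.

Lemma coinduced_open_bigcup (I : Type) (f : I -> set (coinduced g)) :
  (forall i, coinduced_open (f i)) -> coinduced_open (\bigcup_i f i).
Proof.
move=> of_; rewrite /coinduced_open /= preimage_bigcup.
by apply: bigcup_open => i _; exact: of_.
Qed.

HB.instance Definition _ := isOpenTopological.Build (coinduced g)
  coinduced_openT coinduced_openI coinduced_open_bigcup.

End coinduced_topology.

Lemma smooth_on_translation {R : realType} {V : normedModType R} (c : V) :
  smooth_on setT (fun v : V => v + c).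
Proof.
case=> [|k] /=.
  by move=> v _; apply: cvgD; [exact: cvg_id|exact: cvg_cst].
have d v : is_diff v (fun u : V => u + c) (id + 0).
  exact: is_diffD (is_diff_id v) (is_diff_cst c v).
split=> [v _|h]; first exact: ex_diff.
have -> : (fun v => 'D_h (fun u : V => u + c) v) = fun=> h.
  apply/funext => v; rewrite deriveE; last exact: ex_diff.
  have -> : 'd (fun u : V => u + c) v = id + 0 :> (V -> V) by exact: diff_val.
  by rewrite addr0.
exact: smooth_on_cst.
Qed.

(** A curve g that is invariant under a discrete group of periods makes its
    range a 1-manifold, with the parameter as coordinate: a line if the group is
    trivial and a circle otherwise. The map into the Hausdorff space H separates
    its points. *)
Section curve_manifold.
Context {R : realType} {T : choiceType} (g : R -> T) (H : topologicalType)
  (j : coinduced g -> H) (e : R).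
Hypotheses (g_surj : forall x, exists t, g t = x)
  (g_shift : forall s t h, g s = g t -> g (s + h) = g (t + h))
  (e_gt0 : 0 < e) (g_inj : forall s t, g s = g t -> `|s - t| < e -> s = t)
  (H_hausdorff : hausdorff_space H) (j_inj : injective j)
  (jg_continuous : continuous (j \o g)).

Local Notation Q := (coinduced g).
Local Notation gQ := (g : R -> Q).

Lemma coinduced_openE (A : set Q) : open A = open (g @^-1` A).
Proof. by []. Qed.

Lemma curve_continuous : continuous gQ.
Proof. by apply/continuousP => A. Qed.

(** The preimage of the image of U is the union of the translates of U by the
    periods. *)
Lemma curve_open (U : set R) : open U -> open (gQ @` U).
Proof.
move=> oU; rewrite coinduced_openE openE => s [u Uu gu].
have cts : {for s, continuous (fun r => u + (r - s))}.
  by apply: cvgD; [exact: cvg_cst|apply: cvgB; [exact: cvg_id|exact: cvg_cst]].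
have Us : \forall r \near s, U (u + (r - s)).
  apply: cts; rewrite subrr addr0.
  exact: open_nbhs_nbhs.
apply: filterS Us => r Ur; exists (u + (r - s)) => //.
by rewrite (g_shift _ gu) addrC subrK.
Qed.

(** The images of the intervals with rational end points form a basis. *)
Lemma curve_second_countable : @second_countable Q.
Proof.
pose B (ab : rat * rat) : set Q := gQ @` `]ratr ab.1, ratr ab.2[.
exists (range B).
  exact: card_le_trans (card_image_le _ _) (countableP _).
split=> [_ [ab _ <-]|x A /= Ax]; first by apply: curve_open; exact: itv_open.
have [s gs] := g_surj x; rewrite -gs in Ax.
have /nbhs_ballP[r /= r0 rA] := curve_continuous Ax.
have [a] : exists a : rat, ratr a \in `]s - r, s[.
  by apply: rat_in_itvoo; rewrite gtrBl.
rewrite in_itv /= => /andP[ra as_].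
have [b] : exists b : rat, ratr b \in `]s, s + r[.
  by apply: rat_in_itvoo; rewrite ltrDl.
rewrite in_itv /= => /andP[sb br].
exists (B (a, b)); first split.
- by exists (a, b).
- by exists s => //; rewrite /= in_itv /= as_.
- move=> _ [t + <-]; rewrite /= in_itv /= => /andP[at_ tb]; apply: rA.
  by rewrite /ball /= ltr_distlC (lt_trans ra) //= (lt_trans tb).
Qed.

Lemma coinduced_map_continuous : continuous j.
Proof.
apply/continuousP => A oA; rewrite coinduced_openE.
by move/continuousP : jg_continuous; exact.
Qed.

Lemma curve_hausdorff : hausdorff_space Q.
Proof.
have cj := coinduced_map_continuous.
move=> x y xy; apply: j_inj; apply: H_hausdorff => A B Ax By.
have [z [Az Bz]] := xy _ _ (cj x _ Ax) (cj y _ By).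
by exists (j z).
Qed.

Definition curve_time (x : Q) : R := xget 0 [set t | g t = x].

Lemma curve_timeK x : g (curve_time x) = x.
Proof.
by rewrite /curve_time; case: xgetP => // /= no_t; have [t /no_t] := g_surj x.
Qed.

(** Two parameters in an arc of radius e / 2 are closer than e, so that the
    curve is injective on the arc. *)
Definition curve_arc (x : Q) : set R := ball (curve_time x) (e / 2).

Lemma curve_arc_center x : curve_arc x (curve_time x).
Proof. by apply: ballxx; rewrite divr_gt0. Qed.

Lemma curve_arc_open x : open (curve_arc x).
Proof. exact: ball_open. Qed.

Lemma curve_arc_inj x s t :
  curve_arc x s -> curve_arc x t -> g s = g t -> s = t.
Proof.
rewrite /curve_arc /ball /= => xs xt gst; apply: g_inj => //.
rewrite -(subrKA (curve_time x)) (le_lt_trans (ler_normD _ _)) // addrC.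
by rewrite [ltRHS](splitr e) ltrD // distrC.
Qed.

Definition curve_dom (x : Q) : set Q := gQ @` curve_arc x.

Definition curve_chart (x z : Q) : 'rV[R]_1 :=
  const_mx (xget 0 [set s | curve_arc x s /\ g s = z]).

Definition curve_param (x : Q) (y : 'rV[R]_1) : Q := g (y 0 0).

Lemma curve_chartE x s : curve_arc x s -> curve_chart x (g s) = const_mx s.
Proof.
move=> xs; congr const_mx; case: xgetP => [t _ [xt gt]|/(_ s)[]//].
exact: curve_arc_inj xt xs gt.
Qed.

Lemma curve_dom_nbhs x : open_nbhs x (curve_dom x).
Proof.
split; first exact/curve_open/curve_arc_open.
by exists (curve_time x); [exact: curve_arc_center|exact: curve_timeK].
Qed.

Lemma row1_const (y : 'rV[R]_1) : y = const_mx (y 0 0).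
Proof. by apply/rowP => i; rewrite mxE ord1. Qed.

Lemma entry_continuous : continuous (fun y : 'rV[R]_1 => y 0 0).
Proof. by move=> y; exact: coord_continuous. Qed.

Lemma curve_image (x : Q) (U : set R) : U `<=` curve_arc x ->
  curve_chart x @` (gQ @` U) = (fun y : 'rV[R]_1 => y 0 0) @^-1` U.
Proof.
move=> Ux; apply/seteqP; split=> [_ [_ [s Us <-] <-]|y Uy] /=.
  by rewrite curve_chartE ?mxE //; exact: Ux.
exists (g (y 0 0)); first by exists (y 0 0).
by rewrite curve_chartE -?row1_const //; exact: Ux.
Qed.

Lemma curve_image_open x : open (curve_chart x @` curve_dom x).
Proof.
rewrite curve_image //; apply: open_comp; last exact: curve_arc_open.
by move=> y _; exact: entry_continuous.
Qed.

Lemma curve_chartK x z : curve_dom x z -> curve_param x (curve_chart x z) = z.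
Proof. by case=> s xs <-; rewrite curve_chartE // /curve_param mxE. Qed.

Lemma const_mx_continuous : continuous (const_mx : R -> 'rV[R]_1).
Proof.
have -> : const_mx = (fun s : R => s *: (const_mx 1 : 'rV[R]_1)).
  by apply/funext => s; apply/rowP => i; rewrite !mxE mulr1.
by move=> s; apply: cvgZr_tmp; exact: cvg_id.
Qed.

Lemma curve_chart_continuous x z : curve_dom x z ->
  {for z, continuous (curve_chart x)}.
Proof.
case=> s xs <- A; rewrite curve_chartE // => As.
have Bs : nbhs s ((const_mx @^-1` A) `&` curve_arc x).
  apply: filterI; first exact: const_mx_continuous.
  by apply: open_nbhs_nbhs; split=> //; exact: curve_arc_open.
have gB : nbhs (gQ s) (gQ @` ((const_mx @^-1` A) `&` curve_arc x)^°).
  apply: open_nbhs_nbhs; split.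
    by apply: curve_open; exact: open_interior.
  by exists s.
apply: filterS gB => _ [t /interior_subset[At xt] <-] /=.
by rewrite /preimage /= curve_chartE.
Qed.

Lemma curve_param_continuous x y : {for y, continuous (curve_param x)}.
Proof.
by apply: continuous_comp; [exact: entry_continuous|exact: curve_continuous].
Qed.

(** Changes of charts are locally translations by a period. *)
Lemma curve_transition_smooth x x' :
  smooth_on (curve_chart x @` (curve_dom x `&` curve_dom x'))
            (curve_chart x' \o curve_param x).
Proof.
move=> k; apply: Ck_on_local => _ [_ [[s xs <-] [s' xs' gs']] <-].
rewrite curve_chartE //.
pose f (y : 'rV[R]_1) := y + const_mx (s' - s).
pose W := (fun r : R => r + (s' - s)) @^-1` curve_arc x'.
have oW : open W.
  apply: open_comp; last exact: curve_arc_open.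
  by move=> r _; apply: cvgD; [exact: cvg_id|exact: cvg_cst].
pose V := (fun y : 'rV[R]_1 => y 0 0) @^-1` W.
have oV : open V by apply: open_comp => // y _; exact: entry_continuous.
exists V; first by split=> //; rewrite /V /W /= mxE addrC subrK.
apply: (@Ck_on_eq _ _ _ _ _ f).
- exact: oV.
- move=> y /set_mem Vy; rewrite /= /curve_param.
  have -> : g (y 0 0) = g (y 0 0 + (s' - s)).
    have -> : y 0 0 + (s' - s) = s' + (y 0 0 - s) by ring.
    by rewrite (g_shift _ gs') addrC subrK.
  rewrite curve_chartE // /f [y in LHS]row1_const.
  by apply/rowP => i; rewrite !mxE.
exact: Ck_onS (subsetT _) (smooth_on_translation _ k).
Qed.

Definition curve_manifold : smoothManifold R 1 :=
  SmoothManifold curve_hausdorff curve_second_countable curve_dom_nbhs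
    curve_image_open curve_chartK curve_chart_continuous
    (fun x y _ => @curve_param_continuous x y) curve_transition_smooth.

End curve_manifold.

(** * Orbits and bundles along them *)

(** Chain rule for reading a pushed vector in another chart. *)
Lemma transition_dmap {R : realType} {m n : nat} {M : smoothManifold R m}
    {N : smoothManifold R n} (f : M -> N) (x : M) (q : N) v :
    manifold_differentiable f x -> chart_dom q (f x) ->
  differentiable (chart q \o f \o chart_inv x) (chart x x) /\
  transition (f x) q (f x) (dmap f x v) =
    'd (chart q \o f \o chart_inv x) (chart x x) v.
Proof.
move=> [cf df] qfx; have fxfx := chart_dom_refl (f x).
have dtr : differentiable (chart q \o chart_inv (f x)) (chart (f x) (f x)).
  have [+ _] := chart_transition_smooth (f x) q 1%N.
  by apply; exists (f x).
set rep := chart (f x) \o f \o chart_inv x in df.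
have rep_x : rep (chart x x) = chart (f x) (f x).
  by rewrite /rep /= chartK //; exact: chart_dom_refl.
have dtr' : differentiable (chart q \o chart_inv (f x)) (rep (chart x x)).
  by rewrite rep_x.
have fxn : \forall y \near x, chart_dom (f x) (f y).
  by apply: cf; exact: chart_dom_near.
have E : \forall y \near chart x x,
    ((chart q \o chart_inv (f x)) \o rep) y = (chart q \o f \o chart_inv x) y.
  apply: filterS (chart_inv_near (chart_dom_refl x) fxn) => y fy.
  by rewrite /rep /= chartK.
have [dd dE] := near_eq_diff E (differentiable_comp df dtr').
split; first exact: dd.
by rewrite /transition -rep_x dE (diff_comp df dtr').
Qed.

(** The coordinates of the pushed vector are a partial derivative, in a
    direction tangent to M, of the smooth map (t, y) |-> flow t y; fixing y = p
    in it is a composition with an affine map. *)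
Lemma pushed_vector_smooth {R : realType} {m : nat} {M : smoothManifold R m}
    (Phi : smoothFlow M) (p : M) (s0 : R) :
    flow_dom Phi p = setT ->
  exists W : set R, [/\ open W, W s0,
    forall s, W s -> chart_dom (Phi s0 p) (Phi s p) &
    forall b : 'rV[R]_m, smooth_on ((fun y : 'rV[R]_1 => y 0 0) @^-1` W)
      (fun y => transition (Phi (y 0 0) p) (Phi s0 p) (Phi (y 0 0) p)
                  (dmap (Phi (y 0 0)) p b))].
Proof.
move=> Dp; set q0 := Phi s0 p.
have [_ [A [oA As0] FA]] := flow_smooth (flow_dom_full Dp s0).
pose F (z : R^o * 'rV[R]_m) := chart q0 (Phi z.1 (chart_inv p z.2)).
pose emb (y : 'rV[R]_1) : R^o * 'rV[R]_m := (y 0 0, chart p p).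
have demb y := is_diff_embed_time (chart p p) y.
pose W0 : set R := [set s | A ((s : R^o), chart p p)].
pose W1 : set R := [set s | chart_dom q0 (Phi s p)].
have oW0 : open W0.
  pose h (s : R) : R^o * 'rV[R]_m := (s, chart p p).
  by apply: (@open_comp _ _ h) => // s _; exact: cvg_pairl.
have oW1 : open W1.
  apply: open_comp => [s _|]; last by have [] := chart_dom_nbhs q0.
  by apply: flow_curve_continuous; rewrite Dp.
have oW : open ((fun y : 'rV[R]_1 => y 0 0) @^-1` (W0 `&` W1)).
  by apply: open_comp; [move=> y _; exact: coord_continuous|exact: openI].
exists (W0 `&` W1); split.
- exact: openI.
- by split=> //; exact: chart_dom_refl.
- by move=> s [].
move=> b k; have [dF DF] := FA k.+1.
have := Ck_on_comp_affine demb oA (DF (0, b)).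
move=> /(Ck_onS (A := (fun y : 'rV[R]_1 => y 0 0) @^-1` (W0 `&` W1))).
move=> /(_ (fun y Wy => Wy.1)); apply: Ck_on_eq => // y /set_mem [/= Ay Wy].
set s := y 0 0 in Ay Wy *.
have dPhi : manifold_differentiable (Phi s) p.
  by apply: flow_differentiable; exact: flow_dom_full.
have [_ ->] := transition_dmap b dPhi Wy.
have dF' := dF _ Ay; rewrite deriveE //.
have dsp := is_diff_embed_space s (chart p p).
have dsp' := ex_diff (is_diff_def := dsp).
rewrite -[X in 'd X _ b]/(F \o (fun z : 'rV[R]_m => (s, z) : R^o * 'rV[R]_m)).
rewrite (diff_comp dsp' dF') /=.
have -> : 'd (fun z : 'rV[R]_m => (s, z) : R^o * 'rV[R]_m) (chart p p) b
    = (0, b).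
  by rewrite (diff_val (is_diff_def := dsp)).
by [].
Qed.

(** In a chart, the difference quotients of the orbit at time 0 tend to X p and
    are therefore nonzero for short times. *)
Lemma flow_return_isolated {R : realType} {m : nat} {M : smoothManifold R m}
    (Phi : smoothFlow M) (X : M -> 'rV[R]_m) (p : M) :
    is_generator Phi X -> X p != 0 ->
  exists2 e : R, 0 < e & forall t, `|t| < e -> Phi t p = p -> t = 0.
Proof.
move=> Xgen Xp0; have [der val] := Xgen p.
have quot : (fun h : R =>
      h^-1 *: (chart p (Phi (h *: 1 + 0) p) - chart p (Phi 0 p)))
    h @[h --> 0^'] --> X p by rewrite -val.
have : \forall h \near (0 : R)^', Phi h p <> p.
  apply: filterS (cvgr_neq0 _ quot Xp0) => h /= + hp.
  by rewrite addr0 [_ *: 1]mulr1 hp flow0 subrr scaler0 eqxx.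
move=> [e /= e0 eP]; exists e => // t te tp; apply: contrapT => /eqP t0.
by apply: (eP t) => //; rewrite /= sub0r normrN.
Qed.

Section orbit_manifold.
Context {R : realType} {m : nat} {M : smoothManifold R m} (Phi : smoothFlow M).
Variables (p : M) (X : M -> 'rV[R]_m) (e : R).
Hypotheses (Dp : flow_dom Phi p = setT) (Xgen : is_generator Phi X)
  (Xp_neq0 : X p != 0) (e_gt0 : 0 < e)
  (isolated : forall t, `|t| < e -> Phi t p = p -> t = 0).

Lemma flow_in_orbit t : orbit_of Phi p (Phi t p).
Proof. by exists t => //; rewrite Dp. Qed.

Definition orbit_curve (t : R) : set_type (orbit_of Phi p) :=
  exist _ (Phi t p) (mem_set (flow_in_orbit t)).

Local Notation Q := (coinduced orbit_curve).

Definition orbit_incl (x : Q) : M := set_val x.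

Lemma orbit_curve_surj x : exists t, orbit_curve t = x.
Proof.
case: x => q qO; have [t _ tq] := set_mem qO.
by exists t; apply: val_inj.
Qed.

Lemma orbit_curve_eq s t : orbit_curve s = orbit_curve t <-> Phi s p = Phi t p.
Proof. by split=> [/(congr1 val)|] // st; apply: val_inj. Qed.

Lemma orbit_curve_shift s t h : orbit_curve s = orbit_curve t ->
  orbit_curve (s + h) = orbit_curve (t + h).
Proof.
by move=> /orbit_curve_eq st; apply/orbit_curve_eq; rewrite -!flow_add // st.
Qed.

Lemma orbit_curve_inj s t :
  orbit_curve s = orbit_curve t -> `|s - t| < e -> s = t.
Proof.
move=> st lt_e; apply/eqP; rewrite -subr_eq0; apply/eqP; apply: isolated => //.
move/(@orbit_curve_shift _ _ (- t)): st => /orbit_curve_eq ->.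
by rewrite (subrr t) flow0.
Qed.

Lemma orbit_incl_inj : injective orbit_incl.
Proof. by move=> x y /val_inj. Qed.

Lemma orbit_incl_curve_continuous : continuous (orbit_incl \o orbit_curve).
Proof. by move=> t; apply: flow_curve_continuous; rewrite Dp. Qed.

Definition orbit_manifold : smoothManifold R 1 :=
  curve_manifold orbit_curve_surj orbit_curve_shift e_gt0 orbit_curve_inj
    (@manifold_hausdorff _ _ M) orbit_incl_inj orbit_incl_curve_continuous.

Local Notation N := orbit_manifold.

Definition orbit_embedding (x : N) : M := orbit_incl x.
Local Notation iota := orbit_embedding.

Definition orbit_time (x : N) : R := curve_time (x : Q).

Lemma orbit_timeK x : Phi (orbit_time x) p = iota x.
Proof.
by have /(congr1 orbit_incl) := curve_timeK orbit_curve_surj x.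
Qed.

Lemma orbit_curve_timeK (x : N) : (orbit_curve (orbit_time x) : N) = x.
Proof. exact: (curve_timeK orbit_curve_surj x). Qed.

Lemma orbit_chartE (x : N) s : curve_arc e (x : Q) s ->
  chart x (orbit_curve s : N) = const_mx s.
Proof. exact: (curve_chartE orbit_curve_inj). Qed.

Lemma orbit_chart_self (x : N) : chart x x = const_mx (orbit_time x).
Proof.
by rewrite -{2}[x]orbit_curve_timeK orbit_chartE //; exact: curve_arc_center.
Qed.

Lemma orbit_embedding_inj : injective iota.
Proof. exact: orbit_incl_inj. Qed.

Lemma orbit_embedding_range : range iota = orbit_of Phi p.
Proof.
apply/seteqP; split=> [_ [x _ <-]|q qO].
  by rewrite -orbit_timeK; exact: flow_in_orbit.
by have [t _ <-] := qO; exists (orbit_curve t : N).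
Qed.

Lemma orbit_embedding_smooth : smooth_map iota.
Proof.
move=> x; split.
  exact: (coinduced_map_continuous orbit_incl_curve_continuous).
have [_ [A [oA Ax] FA]] := flow_smooth (flow_dom_full Dp (orbit_time x)).
rewrite orbit_chart_self -orbit_timeK.
pose h (y : 'rV[R]_1) : R^o * 'rV[R]_m := (y 0 0, chart p p).
pose F (z : R^o * 'rV[R]_m) :=
  chart (Phi (orbit_time x) p) (Phi z.1 (chart_inv p z.2)).
have dg := is_diff_embed_time (chart p p).
have := smooth_on_comp_affine dg oA FA; rewrite -/h -/F.
have -> : F \o h = chart (Phi (orbit_time x) p) \o iota \o chart_inv x.
  apply/funext => y; rewrite /F /h /= chartK //.
  exact: chart_dom_refl.
exists (h @^-1` A) => //; split; last by rewrite /= /h mxE.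
apply: open_comp => // y _; apply: differentiable_continuous.
exact: (ex_diff (is_diff_def := dg y)).
Qed.

(** In the coordinate of the orbit the embedding is the integral curve through
    iota x, with the time shifted to 0 at x. *)
Lemma dmap_orbit_embedding (x : N) h : dmap iota x h = h 0 0 *: X (iota x).
Proof.
rewrite /dmap orbit_chart_self -orbit_timeK; set s := orbit_time x.
pose c (t : R) : 'rV[R]_m := chart (Phi s p) (Phi t (Phi s p)).
have [dc cX] := flow_curve_diff Xgen (Phi s p).
pose k (y : 'rV[R]_1) : R^o := y 0 0 - s.
have -> : chart (Phi s p) \o iota \o chart_inv x = c \o k.
  apply/funext => y; rewrite /c /k /= flow_add //.
  by rewrite addrC subrK.
have dk : is_diff (const_mx s : 'rV[R]_1) k (fun z => z 0 0).
  apply: is_diff_eq.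
    exact: is_diffB (is_diff_entry _) (is_diff_cst (s : R^o) _).
  by rewrite subr0.
have k0 : k (const_mx s) = 0 by rewrite /k mxE subrr.
have dc0 : differentiable c (k (const_mx s)) by rewrite k0.
rewrite (diff_comp (ex_diff (is_diff_def := dk)) dc0) /=.
have -> : 'd k (const_mx s) h = h 0 0 by rewrite diff_val.
rewrite -[h 0 0 in LHS]mulr1 -[h 0 0 * 1]/(h 0 0 *: (1 : R^o)) linearZ /=.
by rewrite k0 cX.
Qed.

Lemma generator_neq0 t : X (Phi t p) != 0.
Proof. by rewrite -(dmap_flow_generator Dp Xgen) dmap_flow_eq0. Qed.

Lemma orbit_immersion : injective_immersion iota.
Proof.
split; [exact: orbit_embedding_smooth|exact: orbit_embedding_inj|].
move=> x h h'; rewrite !dmap_orbit_embedding => hh.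
have : (h 0 0 - h' 0 0) *: X (iota x) = 0 by rewrite scalerBl hh subrr.
move/eqP; rewrite scaler_eq0 -orbit_timeK (negbTE (generator_neq0 _)) orbF.
by rewrite subr_eq0 => /eqP hE; apply/rowP => i; rewrite ord1.
Qed.

End orbit_manifold.

Section slow_bundle.
Context {R : realType} {m : nat} {M : riemannianManifold R m}
  (Phi : smoothFlow M).
Variables (p : M) (X : M -> 'rV[R]_m) (e : R).
Hypotheses (Dp : flow_dom Phi p = setT) (Xgen : is_generator Phi X)
  (Xp_neq0 : X p != 0) (e_gt0 : 0 < e)
  (isolated : forall t, `|t| < e -> Phi t p = p -> t = 0).

Local Notation N := (orbit_manifold Dp e_gt0 isolated).
Local Notation iota := (@orbit_embedding _ _ _ _ _ _ Dp e_gt0 isolated).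

Variable E : {vspace 'rV[R]_m}.
Hypotheses
  (E_slow : forall v, v \in E <-> (lyap_fwd Phi p v < lyap_fwd Phi p (X p))%E)
  (E_dim : (\dim E).+1 = m).

Local Notation bundle := (orbit_bundle Phi p E).

(** On a closed orbit several times lead to the same point; the fibre does not
    depend on the time because E is cut out by the forward exponent, which is
    constant along the flow. *)
Lemma fiber_orbit_bundle s :
  fiber bundle (Phi s p) = dmap (Phi s) p @` [set` E].
Proof.
apply/seteqP; split=> [v [t _ [u uE [ts <-]]]|_ [v vE <-]]; last first.
  by exists s; [rewrite Dp|exists v].
have tsp : Phi t p = Phi s p by [].
have [Dt Ds] := (flow_dom_orbit Dp t, flow_dom_orbit Dp s).
exists (dmap (Phi (- s)) (Phi s p) (dmap (Phi t) p u)); last exact: dmap_flowVK.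
apply/E_slow; have := lyap_fwd_shift (- s) (dmap (Phi t) p u) Ds.
rewrite (flow_addNK Dp) => ->; rewrite -tsp (lyap_fwd_shift _ _ Dp).
exact/E_slow.
Qed.

Lemma E_basis : exists b : (m.-1).-tuple 'rV[R]_m, basis_of E b.
Proof.
have dE : \dim E = m.-1 by exact: (congr1 predn E_dim).
by exists (tcast dE (vbasis E)); rewrite val_tcast; exact: vbasisP.
Qed.

(** A frame is obtained by transporting a basis of E along the flow. *)
Lemma slow_bundle_smooth : subbundle smooth_on iota m.-1 bundle.
Proof.
split=> [q v [t _ [u _ [<- _]]]|x0].
  by rewrite orbit_embedding_range; exact: flow_in_orbit.
have [b bE] := E_basis.
have [W [oW W0 Wdom Wsmooth]] := pushed_vector_smooth (orbit_time x0) Dp.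
rewrite orbit_timeK in Wdom Wsmooth.
pose A := W `&` curve_arc e (x0 : coinduced _).
pose U : set N := (orbit_curve Dp : R -> N) @` A.
have oA : open A by apply: openI => //; exact: curve_arc_open.
have UE x : U x -> exists2 s, A s & [/\ x = (orbit_curve Dp s : N),
    chart x0 x 0 0 = s & iota x = Phi s p].
  case=> s As <-; exists s => //; split=> //.
  by rewrite orbit_chartE ?mxE //; case: As.
exists U, (fun x => map_tuple (dmap (Phi (chart x0 x 0 0)) p) b); split.
- split.
    by apply: (curve_open (@orbit_curve_shift _ _ _ _ _ Dp)) => //; exact: oA.
  exists (orbit_time x0); last exact: orbit_curve_timeK.
  by split=> //; exact: curve_arc_center.
- move=> x /UE[s [Ws xs] [-> _ _]]; split; first by exists s.
  exact: Wdom.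
- move=> x /UE[s _ [_ -> ->]].
  pose f := linfun (dmap (Phi s) p).
  have fE v : f v = dmap (Phi s) p v by exact: linfun_dmapE.
  have fb : map (dmap (Phi s) p) b = map f b.
    by apply: eq_map => v; rewrite fE.
  have f_inj : (E :&: lker f)%VS = 0%VS.
    apply/eqP; rewrite -subv0; apply/subvP => v; rewrite memv_cap => /andP[_].
    by rewrite memv_ker fE dmap_flow_eq0 // memv0.
  have := limg_basis_of f_inj bE; rewrite basisEfree -fb => /and3P[fr sp _].
  split; first exact: fr.
  have -> : span (map_tuple (dmap (Phi s) p) b) = (f @: E)%VS.
    by rewrite /= fb -limg_span (span_basis bE).
  rewrite fiber_orbit_bundle; apply/seteqP; split=> [_ [v vE <-]|v] /=.
    by rewrite -fE memv_img.
  by move=> /memv_imgP[u uE ->]; exists u.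
- move=> i k; have := Wsmooth (tnth b i) k.
  have -> : chart x0 @` U = (fun y : 'rV[R]_1 => y 0 0) @^-1` A.
    by apply: (curve_image (@orbit_curve_inj _ _ _ _ _ _ Dp isolated)) => ? [].
  have oeA : open ((fun y : 'rV[R]_1 => y 0 0) @^-1` A).
    by apply: open_comp oA => y _; exact: coord_continuous.
  move/(Ck_onS (A := (fun y : 'rV[R]_1 => y 0 0) @^-1` A)).
  move=> /(_ (fun y Ay => Ay.1)); apply: Ck_on_eq => // y /set_mem [Wy xy].
  have cy : chart x0 (chart_inv x0 y) 0 0 = y 0 0.
    by have := orbit_chartE xy => /= ->; rewrite mxE.
  have iy : iota (chart_inv x0 y) = Phi (y 0 0) p by [].
  by cbv zeta beta; rewrite tnth_map cy iy.
Qed.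

Lemma slow_bundle_invariant : invariant_bundle Phi iota bundle.
Proof.
move=> x t _; rewrite -orbit_timeK flow_add // !fiber_orbit_bundle.
rewrite image_comp; apply: eq_imagel => v _ /=.
by rewrite dmap_flow_add.
Qed.

Lemma tangent_space_orbit (x : N) :
  tangent_space iota x = range (fun a : R => a *: X (iota x)).
Proof.
apply/seteqP; split=> [_ [h _ <-]|_ [a _ <-]].
  by exists (h 0 0) => //; rewrite (dmap_orbit_embedding Xgen).
by exists (const_mx a) => //; rewrite (dmap_orbit_embedding Xgen) // mxE.
Qed.

Lemma slow_complement v : exists a, v - a *: X p \in E.
Proof.
have XE : X p \notin E by apply/negP => /E_slow; rewrite ltxx.
have lt_dim : (\dim E < \dim (E + <[X p]>))%N.
  rewrite ltn_neqAle dimvS ?addvSl // andbT; apply: contra XE => /eqP dimE.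
  suff /eqP -> : E == (E + <[X p]>)%VS by rewrite memvE addvSr.
  by rewrite eqEdim addvSl dimE /=.
have full : (E + <[X p]>)%VS = fullv.
  apply/eqP; rewrite eqEdim subvf; apply: leq_trans lt_dim.
  by rewrite dimvf /dim /= mul1n E_dim.
have : v \in (E + <[X p]>)%VS by rewrite full memvf.
by case/memv_addP => u uE [_ /vlineP[a ->] ->]; exists a; rewrite addrK.
Qed.

Hypotheses
  (gap_fwd : (ereal_sup (lyap_fwd Phi p @` [set` E]) < lyap_fwd Phi p (X p))%E)
  (gap_bwd : (lyap_bwd Phi p (X p) <
     ereal_inf (lyap_bwd Phi p @` ([set` E] `\ 0%R)))%E).

(** The flow transports the splitting of the tangent space at p into E and the
    line of X p, and preserves exponents, so all conditions reduce to p. *)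
Lemma orbit_NAIM : generalized_relative_NAIM Phi iota bundle.
Proof.
have XE : X p \notin E by apply/negP => /E_slow; rewrite ltxx.
have tangentE x : tangent_space iota x =
    range (fun a : R => dmap (Phi (orbit_time x)) p (a *: X p)).
  rewrite tangent_space_orbit -orbit_timeK; apply: eq_imagel => a _.
  by rewrite dmapZ (dmap_flow_generator Dp Xgen).
have fiberE x : fiber bundle (iota x) = dmap (Phi (orbit_time x)) p @` [set` E].
  by rewrite -orbit_timeK fiber_orbit_bundle.
split.
- exact: orbit_immersion.
- move=> x t _; rewrite orbit_embedding_range -orbit_timeK flow_add //.
  exact: flow_in_orbit.
- rewrite subn1; have [sub loc] := slow_bundle_smooth; split=> // x0.
  have [U [b [xU Udom bE bsmooth]]] := loc x0.
  by exists U, b; split=> // i; exact: bsmooth.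
- exact: slow_bundle_invariant.
- move=> x v; set L := dmap (Phi (orbit_time x)) p.
  pose v0 := dmap (Phi (- orbit_time x)) (iota x) v.
  have Lv0 : L v0 = v by rewrite /L /v0 -orbit_timeK dmap_flowVK.
  have [a vaE] := slow_complement v0.
  exists (L (v0 - a *: X p), L (a *: X p)); split=> /=.
    rewrite fiberE tangentE; split; first by exists (v0 - a *: X p).
      by exists a.
    by rewrite -dmapD subrK.
  case=> u w [/=]; rewrite fiberE tangentE => -[u0 u0E <-] [b _ <-] vE.
  have v0E : v0 = u0 + b *: X p.
    apply: (dmap_flow_inj Dp (t := orbit_time x)).
    by rewrite -/L Lv0 vE /L dmapD.
  have : (b - a) *: X p \in E.
    have -> : (b - a) *: X p = (v0 - a *: X p) - u0.
      by rewrite v0E scalerBl addrAC (addrC u0) addrK.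
    by rewrite memvB.
  rewrite rpredZeq (negbTE XE) orbF subr_eq0 => /eqP ba.
  by rewrite v0E ba addrK.
- move=> x; rewrite fiberE tangentE.
  apply: lt_le_trans (_ : (lyap_fwd Phi p (X p) <= _)%E).
    apply: le_lt_trans gap_fwd; apply: ge_ereal_sup => _ [_ [v vE <-] <-].
    rewrite -orbit_timeK (lyap_fwd_shift _ _ Dp); apply: ereal_sup_ubound.
    by exists v.
  apply: le_ereal_inf_tmp => _ [_ [[a _ <-] /= La0] <-].
  rewrite -orbit_timeK (lyap_fwd_shift _ _ Dp).
  rewrite (exponentZ (lyap_fwd_exponent Dp)) //.
  by apply: contra_notN La0 => /eqP ->; rewrite scale0r dmap0.
- move=> x; rewrite fiberE tangentE.
  apply: le_lt_trans (_ : (_ <= lyap_bwd Phi p (X p))%E) _.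
    apply: ge_ereal_sup => _ [_ [a _ <-] <-].
    rewrite -orbit_timeK (lyap_bwd_shift _ _ Dp).
    exact: exponentZ_le (lyap_bwd_exponent Dp) _ _.
  apply: lt_le_trans gap_bwd _.
  apply: le_ereal_inf_tmp => _ [_ [[v vE <-] /= Lv0] <-].
  rewrite -orbit_timeK (lyap_bwd_shift _ _ Dp); apply: ereal_inf_lbound.
  by exists v => //; split=> // v0; apply: Lv0; rewrite v0 dmap0.
Qed.

End slow_bundle.

Theorem theorem7 (R : realType) (m : nat) (M : riemannianManifold R m)
  (Mcomplete : complete_riemannian M)
  (Phi : smoothFlow M) (X : M -> 'rV[R]_m)
  (Xsmooth : smooth_vector_field X) (Xgen : is_generator Phi X)
  (p : M) (Xp_neq0 : X p != 0) (Dp : flow_dom Phi p = setT)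
  (Hbwd : (lyap_bwd Phi p (X p) < ereal_inf (lyap_bwd Phi p @` unit_normal p (X p)))%E)
  (Hfwd : (dual_adde (m%:R%:E * perron_coef m (lyap_fwd Phi p) (colyap_fwd Phi p))
             (- ereal_inf [set colyap_fwd Phi p (flat p u) | u in unit_normal p (X p)])
           < lyap_fwd Phi p (X p))%E)
  (vs : seq 'rV[R]_m) (vs_basis : basis_of fullv (X p :: vs))
  (Hmax : forall v, v \in vs -> (lyap_fwd Phi p v <= lyap_fwd Phi p (X p))%E) :
  exists Ep : {vspace 'rV[R]_m},
    unique (fun F : {vspace 'rV[R]_m} =>
      [/\ (\dim F).+1 = m,
          X p \notin F,
          (lyap_fwd Phi p (X p) > ereal_sup (lyap_fwd Phi p @` [set` F]))%E &
          (lyap_bwd Phi p (X p) <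
           ereal_inf (lyap_bwd Phi p @` ([set` F] `\ 0%R)))%E]) Ep /\
    exists (N : smoothManifold R 1) (iota : N -> M),
      [/\ injective_immersion iota,
          range iota = orbit_of Phi p,
          subbundle smooth_on iota m.-1 (orbit_bundle Phi p Ep),
          invariant_bundle Phi iota (orbit_bundle Phi p Ep) &
          generalized_relative_NAIM Phi iota (orbit_bundle Phi p Ep)].
Proof.
have lamE := lyap_fwd_exponent Dp.
have lam_max v : (lyap_fwd Phi p v <= lyap_fwd Phi p (X p))%E.
  apply: (exponent_span_le lamE (s := X p :: vs)); last first.
    by rewrite (span_basis vs_basis) memvf.
  by move=> u; rewrite inE => /predU1P[->//|/Hmax].
have [E [E_slow E_dim]] := slow_subspace_ex Dp Hfwd lam_max.
have XE : X p \notin E by apply/negP => /E_slow; rewrite ltxx.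
have gap_fwd :
    (ereal_sup (lyap_fwd Phi p @` [set` E]) < lyap_fwd Phi p (X p))%E.
  by apply: lyap_fwd_gap => // [|v /E_slow//]; exact: lam_gtNy Hfwd.
have gap_bwd := lyap_bwd_gap Dp Xp_neq0 XE Hbwd.
exists E; split.
  split=> [//|F [F_dim _ F_fwd _]]; apply/esym/eqP.
  rewrite eqEdim; apply/andP; split; last by rewrite -ltnS E_dim F_dim.
  apply/subvP => v vF; apply/E_slow; apply: le_lt_trans F_fwd.
  by apply: ereal_sup_ubound; exists v.
have [e e_gt0 isolated] := flow_return_isolated Xgen Xp_neq0.
exists (orbit_manifold Dp e_gt0 isolated).
exists (@orbit_embedding _ _ _ _ _ _ Dp e_gt0 isolated).
split.
- exact: orbit_immersion.
- exact: orbit_embedding_range.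
- exact: (slow_bundle_smooth Dp e_gt0 isolated E_slow E_dim).
- exact: (slow_bundle_invariant E_slow).
- exact: (orbit_NAIM Dp Xgen Xp_neq0 e_gt0 isolated E_slow E_dim).
Qed.
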